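(* Let $p(n)$ denote the number of partitions of $n$. For all integers $n>6$, \[ \frac{p(n-1)}{p(n)}\left(1+\frac{240}{(24n)^{3/2}}\right) > \frac{p(n)}{p(n+1)}. \]
   Context: $p(n)$ is the partition function: the number of ways of writing $n$ as an unordered sum of positive integers. *)

(* Defs.v *)
From mathcomp Require Import all_boot.
Set Implicit Arguments. Unset Strict Implicit. Unset Printing Implicit Defensive.

(* A partition of n (an unordered sum of positive integers equal to n) is
   encoded by its multiplicity function: m i = number of parts equal to i+1,
   for parts 1..n (each multiplicity is at most n, so lies in 'I_n.+1).
   The partition is valid iff sum_i (i+1) * m i = n. *)
Definition is_partition_mult (n : nat) (m : {ffun 'I_n -> 'I_n.+1}) : bool :=
  \sum_(i < n) i.+1 * m i == n.

Definition partition_number (n : nat) : nat :=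
  #|[pred m : {ffun 'I_n -> 'I_n.+1} | is_partition_mult m]|.

(* Main.v *)
(* Write [p(j) exp(-tj)] as a Fourier coefficient of the generating function
   [prod_(m <= N) 1/(1 - z^m)] on the circle [|z| = exp(-t)], where [N >= j] is finite.
   Let [g] be its modulus, normalised to [1] on the real axis, and [psi] its argument minus
   [n theta].  With [u], [C], [S] the integrals of [g cos psi], [g cos psi cos theta] and
   [g sin psi sin theta], the numbers [p(n)], [p(n-1)], [p(n+1)] are proportional to [u],
   [C - S], [C + S], so [p(n)^2 - p(n-1) p(n+1)] is governed by
   [u^2 - C^2 + S^2 <= 2 u B + S^2], where [B] is the integral of [g (1 - cos theta)].
   Choose [t] so that the mean [sum_m m/(exp(mt) - 1)] is [n].  Then [psi = O(theta^3)] and [g] is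
   between two Gaussians [exp(- c theta^2 / t^3)] near [0] and exponentially small in [1/t]
   elsewhere, whence [B/u] is at most a constant times [t^3], with a constant small enough for
   [t <= 0.0288], that is for [n >= 2000].  The cases [n < 2000] are settled by
   computation, using the pentagonal recurrence for [p]. *)
Require Import Defs.
From mathcomp Require all_boot all_algebra ring zify.

(** * Partitions with bounded parts *)

Module PartitionCount.
Import mathcomp.boot.all_boot mathcomp.algebra.all_algebra.
Import ring zify.
Import GRing.Theory Num.Theory.
Set Implicit Arguments. Unset Strict Implicit.

(** The constants have room to spare. Asymptotically [1 - p(n-1) p(n+1) / p(n)^2] is the reciprocal
    of the variance, about [0.304 t^3]: a Gaussian of parameter [V] makes [2 B / u] close to
    [1 / V], and [S^2 / u^2] is only of order [t^4]. The claim allows [0.963 t^3]. This factor of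
    three pays for the mismatch between the two Gaussians and for rational constants that already
    hold at [t = 0.0288]; what comes out is [0.89 t^3]. Complex analysis and infinite series are
    avoided. With finitely many factors, the integrals are real integrals of explicit functions, and
    they are identified with partition counts because both obey the same recurrence in the largest
    part allowed and vanish at negative indices. The pentagonal recurrence likewise comes from a
    finite polynomial identity. *)

Fixpoint parts_le (N j : nat) : nat :=
  match N with
  | 0 => (j == 0 : nat)
  | N'.+1 => \sum_(b < j.+1 | N'.+1 * b <= j) parts_le N' (j - N'.+1 * b)
  end.

(** A partition with parts at most [N.+1] either avoids the part [N.+1] or loses one copy of it. The
    Fourier coefficients obey this same recurrence, which is how the two are matched. *)
Lemma parts_le_rec N j :
  parts_le N.+1 j = parts_le N j + (if N.+1 <= j then parts_le N.+1 (j - N.+1) else 0).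
Proof.
rewrite [LHS]/= big_mkcond big_ord_recl /= muln0 subn0; congr addn.
case: (leqP N.+1 j) => [le|lt]; last first.
  apply: big1 => i _; rewrite ifF //; apply/negbTE; rewrite -ltnNge.
  by apply: leq_trans lt _; rewrite /bump /= add1n mulnS leq_addr.
rewrite [in RHS]big_mkcond /=.
rewrite (big_ord_widen j (fun i => if N.+1 * i <= j - N.+1 then parts_le N (j - N.+1 - N.+1 * i) else 0)
  ); last by rewrite -{2}(subnK le) addnS ltnS leq_addr.
rewrite [RHS]big_mkcond /=; apply: eq_bigr => i _; rewrite /bump /= add1n mulnS.
rewrite leq_subRL // subnDA.
case: ltnP => // h; rewrite ifF //; apply/negbTE; rewrite -ltnNge.
have h1 : N.+1 * (j - N.+1).+1 <= N.+1 * i by rewrite leq_mul2l h orbT.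
apply: leq_trans (_ : N.+1 + N.+1 * (j - N.+1).+1 <= _); last by rewrite leq_add2l.
rewrite mulSn -{1}(subnKC le) -addnS leq_add2l; exact: leq_addr.
Qed.

Local Open Scope ring_scope.
(** Cutting every geometric series at multiplicity [B] leaves the coefficients of degree at most [B]
    intact: a larger multiplicity already exceeds the degree. *)
Lemma coef_prod_geometric (B N j : nat) : (j <= B)%N ->
  (\prod_(i < N) \sum_(b < B.+1) 'X^(i.+1 * b) : {poly int})`_j = (parts_le N j)%:R.
Proof.
elim: N j => [|N IH] j jB; first by rewrite big_ord0 coef1.
rewrite big_ord_recr /= mulr_sumr coef_sum natr_sum.
rewrite [RHS]big_mkcond /= (big_ord_widen B.+1 (fun b => if (N.+1 * b <= j)%N then
   ((parts_le N (j - N.+1 * b)%N)%:R : int) else 0)) // [RHS]big_mkcond /=.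
apply: eq_bigr => b _; rewrite coefMXn.
case: (leqP (N.+1 * b) j) => h.
  rewrite IH ?(leq_trans (leq_subr _ _)) //.
  by rewrite ltnS (leq_trans _ h) // mulSn leq_addr.
by case: ifP.
Qed.

Lemma partition_number_parts_le n : partition_number n = parts_le n n.
Proof.
apply/eqP; rewrite -(eqr_nat int) -(coef_prod_geometric _ (leqnn n)); apply/eqP.
(* Distributing the product over the sums indexes the terms by multiplicity functions, the encoding
   counted by [partition_number]. *)
rewrite bigA_distr_bigA /= coef_sum /partition_number -sum1_card natr_sum.
rewrite big_mkcond /=; apply: eq_bigr => f _.
rewrite unfold_in /= /is_partition_mult.
rewrite (_ : \prod_i _ = 'X^(\sum_(i < n) i.+1 * f i)%N); last first.
  by rewrite (big_morph (fun k => 'X^k : {poly int}) (exprD 'X) (expr0 'X)).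
rewrite coefXn eq_sym; by case: eqP.
Qed.

(** Here and in the next lemmas MathComp's [nat] operations are traded for Stdlib's, for use in the
    analytic part. *)
Lemma parts_le_small N j : (j < N.+1)%coq_nat -> parts_le N.+1 j = parts_le N j.
Proof. by move/ltP => h; rewrite parts_le_rec leqNgt h addn0. Qed.

Lemma parts_le_step N j :
  parts_le N.+1 (N.+1 + j)%coq_nat = (parts_le N (N.+1 + j)%coq_nat + parts_le N.+1 j)%coq_nat.
Proof. by rewrite [LHS]parts_le_rec !plusE leq_addr addKn. Qed.

Lemma parts_le_partition_number N n : (n <= N)%coq_nat -> parts_le N n = partition_number n.
Proof.
rewrite partition_number_parts_le => /leP h; rewrite -(subnK h); elim: (N - n)%N => // k IH.
by rewrite addSn parts_le_rec IH ltnNge leq_addl /= addn0.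
Qed.

(** * The pentagonal recurrence *)

Local Close Scope ring_scope.

(* Shifting the index makes truncated subtraction agree with [p = 0] on negative integers. *)
Definition partition_pred (i : nat) : nat := if i is i'.+1 then partition_number i' else 0.

(* The sums of the terms with positive and with negative sign of
   [sum_(i >= 0) (-1)^i (q (j_i) + q (j_i - (k + i)))], where [q := partition_pred], [j_0 = j]
   and [j_(i+1) = j_i - (3 (k + i) + 1)]; these are the increments of the pentagonal numbers. *)
Fixpoint pent_sums (f k j : nat) : nat * nat :=
  match f with
  | 0 => (0, 0)
  | f'.+1 =>
    let s := pent_sums f' k.+1 (j - k - (2 * k + 1)) in
    (partition_pred j + partition_pred (j - k) + s.2, s.1)
  end.

Lemma pent_sumsS f k j :
  let s := pent_sums f k.+1 (j - k - (2 * k + 1))%coq_nat in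
  pent_sums f.+1 k j = ((partition_pred j + partition_pred (j - k)%coq_nat + s.2)%coq_nat, s.1).
Proof. by []. Qed.

Local Open Scope ring_scope.
Local Notation Xn i := ('X^i : {poly int}).

Definition euler_factors (n k : nat) : {poly int} := \prod_(k <= i < n) (1 - Xn i.+1).
(** The generalised pentagonal numbers [k (3k - 1) / 2] and, next, [k (3k + 1) / 2], in a form
    without division that matches the exponents in Shanks' identity. *)
Definition pent1 (k : nat) : nat := (k * k + 'C(k, 2))%N.
Definition pent2 (k : nat) : nat := (k * k + 'C(k.+1, 2))%N.
Definition shanks_term (n k : nat) : {poly int} :=
  (-1) ^+ k * euler_factors n k * Xn (n * k + 'C(k.+1, 2)).
Definition pent_poly (n : nat) : {poly int} :=
  \sum_(k < n) (-1) ^+ k.+1 * (Xn (pent1 k.+1) + Xn (pent2 k.+1)).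

(* Shanks' identity: passing from [n] to [n.+1] the left-hand side telescopes in [k]. *)
Lemma shanks n : \sum_(k < n.+1) shanks_term n k = 1 + pent_poly n.
Proof.
elim: n => [|n IH].
  rewrite big_ord1 /shanks_term /euler_factors /pent_poly big_ord0 big_geq //.
  by rewrite mul0n !mulr1 expr0 addr0.
(* The telescoping certificate. Its value [0] at [k = 0] leaves only [U n.+1], up to sign the
   monomial of exponent [pent1 n.+1]; the new last term [k = n.+1] supplies the one of exponent
   [pent2 n.+1]. *)
pose U k : {poly int} :=
  if k is k'.+1 then (-1) ^+ k * euler_factors n k' * Xn (n.+1 * k + 'C(k, 2)) else 0.
have step k : (k < n.+1)%N ->
    shanks_term n.+1 k = shanks_term n k + (U k.+1 - U k).
  move=> lekn; rewrite /shanks_term.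
  have -> : euler_factors n.+1 k = euler_factors n k * (1 - Xn n.+1).
    by rewrite /euler_factors big_nat_recr.
  case: k lekn => [|k] lekn.
    rewrite /U /euler_factors !muln0 !expr0 !mulr1 !mul1r expr1 subr0 muln1 addn0 /=.
    by ring.
  rewrite /U; have -> : euler_factors n k = (1 - Xn k.+1) * euler_factors n k.+1.
    by rewrite /euler_factors big_ltn.
  rewrite (exprS _ k.+1) [(n.+1 * k.+2)%N]mulnS [(n.+1 * k.+1)%N]mulSn.
  rewrite [('C(k.+2, 2))%N]binS bin1 !exprD.
  by ring.
rewrite big_ord_recr /= (eq_bigr (fun k : 'I_n.+1 => shanks_term n k + (U k.+1 - U k))); last first.
  by move=> k _; rewrite step.
rewrite big_split /= IH -(big_mkord xpredT (fun k => U k.+1 - U k)) telescope_sumr //= subr0.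
rewrite /pent_poly [in RHS]big_ord_recr /= -!addrA; congr (_ + (_ + _)).
rewrite /shanks_term /pent1 /pent2 /euler_factors !big_geq // !mulr1 mulrDr.
by [].
Qed.

(** The term [k = 0] of Shanks' sum is the whole Euler product and all others are divisible by
    ['X^n.+1]. *)
Lemma euler_factors_pent n :
  exists Q : {poly int}, euler_factors n 0 = 1 + pent_poly n + Q * Xn n.+1.
Proof.
rewrite -shanks big_ord_recl /= {1}/shanks_term muln0 expr0 !mul1r expr0 mulr1.
exists (- \sum_(k < n) (-1) ^+ k.+1 * euler_factors n k.+1 * Xn (n * k + k + 'C(k.+1, 2))).
rewrite mulNr mulr_suml -addrA -sumrB big1 ?addr0 // => k _.
apply/eqP; rewrite subr_eq0; apply/eqP; rewrite /shanks_term /bump /= add1n -!mulrA -!exprD.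
congr (_ * (_ * _)); congr ('X^_); rewrite binS bin1; lia.
Qed.

(** Each truncated geometric series times its Euler factor is [1 - 'X^(i.+1 * n.+1)], congruent to
    [1] modulo ['X^n.+1], and this congruence is stable under products. *)
Lemma coef_geometric_euler n m : (0 < m <= n)%N ->
  ((\prod_(i < n) \sum_(b < n.+1) Xn (i.+1 * b)) * euler_factors n 0)`_m = 0.
Proof.
case/andP=> m0 mn; rewrite /euler_factors big_mkord -big_split /=.
suff [Q ->] : exists Q : {poly int},
    \prod_(i < n) ((\sum_(b < n.+1) Xn (i.+1 * b)) * (1 - Xn i.+1)) = 1 + Q * Xn n.+1.
  by rewrite coefD coef1 coefMXn ltnS mn (gtn_eqF m0) addr0.
apply: (big_ind (fun f => exists Q : {poly int}, f = 1 + Q * Xn n.+1)).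
- by exists 0; rewrite mul0r addr0.
- by move=> _ _ [P ->] [Q ->]; exists (P + Q + P * Q * Xn n.+1); ring.
- move=> i _; exists (- Xn (i * n.+1)).
  have -> : \sum_(b < n.+1) Xn (i.+1 * b) = \sum_(b < n.+1) (Xn i.+1) ^+ b.
    by apply: eq_bigr => b _; rewrite exprM.
  have := subrX1 (Xn i.+1) n.+1; rewrite -exprM mulSn exprD => E.
  have -> : forall S : {poly int}, S * (1 - Xn i.+1) = - ((Xn i.+1 - 1) * S).
    by move=> S; ring.
  by rewrite -E; ring.
Qed.

Definition partition_shift (m g : nat) : nat := if (g <= m)%N then partition_number (m - g) else 0.

(** Replace the Euler product by the pentagonal polynomial in [coef_geometric_euler]; terms with a
    pentagonal number above [m] are zero by [partition_shift]. *)
Lemma pentagonal_recurrence n m : (0 < m <= n)%N ->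
  (partition_number m)%:R = \sum_(k < n) (-1) ^+ k *
    ((partition_shift m (pent1 k.+1))%:R + (partition_shift m (pent2 k.+1))%:R) :> int.
Proof.
move=> mn; have [m0 lemn] := andP mn; have := coef_geometric_euler mn.
set G := (\prod_(i < n) _); have [Q ->] := euler_factors_pent n.
have coefG g : (G * Xn g)`_m = (partition_shift m g)%:R.
  rewrite coefMXn /partition_shift ltnNge; case: (leqP g m) => //= h.
  have le : (m - g <= n)%N by rewrite (leq_trans (leq_subr _ _)).
  by rewrite /G coef_prod_geometric // parts_le_partition_number //; apply/leP.
rewrite !mulrDr mulr1 mulrA coefD coefMXn ltnS lemn addr0 coefD.
have -> : G`_m = (partition_number m)%:R.
  by rewrite -[G]mulr1 -(expr0 'X) coefG /partition_shift subn0.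
rewrite /pent_poly mulr_sumr coef_sum => /eqP; rewrite addr_eq0 => /eqP ->.
rewrite -sumrN; apply: eq_bigr => k _.
have -> : G * ((-1) ^+ k.+1 * (Xn (pent1 k.+1) + Xn (pent2 k.+1)))
   = (-1) ^+ k.+1 *: (G * Xn (pent1 k.+1) + G * Xn (pent2 k.+1)).
  by rewrite -mulrDr mulrCA -mul_polyC rmorphXn rmorphN rmorph1.
by rewrite coefZ coefD !coefG exprS mulN1r mulNr opprK.
Qed.

Lemma pent1S k : pent1 k.+1 = (pent1 k + 3 * k + 1)%N.
Proof. by rewrite /pent1 binS bin1; lia. Qed.

Lemma pent2E k : pent2 k = (pent1 k + k)%N.
Proof. by rewrite /pent2 /pent1 binS bin1; lia. Qed.

Lemma pent_sumsE f k m : (0 < k)%N ->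
  ((pent_sums f k (m.+1 - pent1 k)).1%:R - (pent_sums f k (m.+1 - pent1 k)).2%:R : int) =
  \sum_(i < f) (-1) ^+ i *
    ((partition_shift m (pent1 (k + i)))%:R + (partition_shift m (pent2 (k + i)))%:R).
Proof.
have shift g : partition_pred (m.+1 - g) = partition_shift m g.
  by rewrite /partition_pred /partition_shift; case: (leqP g m) => h; [rewrite subSn | rewrite (eqP (h : (m.+1 <= g)%N))].
elim: f k => [|f IH] k k0; first by rewrite big_ord0 subr0.
rewrite big_ord_recl addn0 expr0 mul1r /=.
have -> : (m.+1 - pent1 k - k - (2 * k + 1) = m.+1 - pent1 k.+1)%N by rewrite pent1S; lia.
rewrite -[(m.+1 - pent1 k - k)%N]subnDA -pent2E !shift !natrD.
(* The sign change of the shifted sum matches the exchange of the two components in [pent_sums]. *)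
rewrite (eq_bigr (fun i : 'I_f => - ((-1) ^+ i * ((partition_shift m (pent1 (k.+1 + i)))%:R
   + (partition_shift m (pent2 (k.+1 + i)))%:R)))); last first.
  by move=> i _; rewrite /bump /= add1n exprS mulN1r mulNr addnS addSn.
rewrite sumrN -IH //; ring.
Qed.

(** The truncated subtraction is exact because the difference is [p(m)]. The index starts at [m]
    since [m.+1 - pent1 1 = m]. *)
Lemma partition_number_pent_sums f m : (0 < m)%coq_nat -> (m <= f)%coq_nat ->
  partition_number m = ((pent_sums f 1 m).1 - (pent_sums f 1 m).2)%coq_nat.
Proof.
move=> /ltP m0 /leP mf.
have := @pentagonal_recurrence f m; rewrite m0 mf => /(_ isT).
have := @pent_sumsE f 1 m isT; rewrite /pent1 /= subn1 /= => <- E.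
set s := pent_sums f 1 m in E *.
have {}E : ((partition_number m + s.2)%:R = s.1%:R :> int) by rewrite natrD E subrK.
by move/eqP: E; rewrite eqr_nat => /eqP <-; rewrite minusE addnK.
Qed.
End PartitionCount.

From Stdlib Require Import Reals Lra Lia Ranalysis5 List NArith.
From Coquelicot Require Import Coquelicot.
Import PartitionCount.
Open Scope R_scope.

(** * Finite sums and geometric series *)

(* The index starts at [1]: [f 0] is not summed. *)
Fixpoint psum (f : nat -> R) (N : nat) : R :=
  match N with O => 0 | S N' => psum f N' + f N end.

Lemma psum_ext f g N : (forall m, (1 <= m <= N)%nat -> f m = g m) -> psum f N = psum g N.
Proof.
  induction N as [|N IH]; intros H; simpl; [reflexivity|].
  rewrite IH, H; [reflexivity|lia|]. intros m Hm; apply H; lia.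
Qed.

Lemma psum_le f g N : (forall m, (1 <= m <= N)%nat -> f m <= g m) -> psum f N <= psum g N.
Proof.
  induction N as [|N IH]; intros H; simpl; [lra|].
  apply Rplus_le_compat; [apply IH; intros m Hm|]; apply H; lia.
Qed.

Lemma psum_plus f g N : psum (fun m => f m + g m) N = psum f N + psum g N.
Proof. induction N as [|N IH]; simpl; [|rewrite IH]; ring. Qed.

Lemma psum_scal c f N : psum (fun m => c * f m) N = c * psum f N.
Proof. induction N as [|N IH]; simpl; [|rewrite IH]; ring. Qed.

Lemma psum_swap (f : nat -> nat -> R) K N :
  psum (fun m => psum (fun k => f m k) K) N = psum (fun k => psum (fun m => f m k) N) K.
Proof.
  induction N as [|N IH]; simpl.
  - induction K as [|K IH]; simpl; [|rewrite <- IH]; ring.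
  - rewrite IH, <- psum_plus. reflexivity.
Qed.

Lemma Rabs_psum f N : Rabs (psum f N) <= psum (fun m => Rabs (f m)) N.
Proof.
  induction N as [|N IH]; simpl; [rewrite Rabs_R0; lra|].
  eapply Rle_trans; [apply Rabs_triang|]. lra.
Qed.

(** The remainder is kept exact: with a cutoff [K] for [N], the identity also expands [x / (1 - x)]
    into [K] explicit powers plus a multiple of [x ^ K]. *)
Lemma sum_pow0_tail x N : 0 <= x < 1 ->
  psum (fun m => x ^ m) N + x ^ N * (x / (1 - x)) = x / (1 - x).
Proof.
  intros Hx. induction N as [|N IH]; simpl; [field; lra|].
  rewrite <- IH at 2. field; lra.
Qed.

Lemma sum_pow0_le x N : 0 <= x < 1 -> psum (fun m => x ^ m) N <= x / (1 - x).
Proof.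
  intros Hx. pose proof (sum_pow0_tail x N Hx).
  assert (0 <= x ^ N * (x / (1 - x))); [|lra].
  apply Rmult_le_pos; [apply pow_le; lra|]. apply Rdiv_le_0_compat; lra.
Qed.

Lemma sum_pow1_tail x N : 0 <= x < 1 ->
  psum (fun m => INR m * x ^ m) N
     + x ^ N * (INR N * (x / (1 - x)) + x / (1 - x) ^ 2) = x / (1 - x) ^ 2.
Proof.
  intros Hx. induction N as [|N IH]; [simpl; field; lra|].
  cbn [psum]. rewrite <- IH at 2. rewrite S_INR. simpl. field; lra.
Qed.

Lemma sum_pow1_le x N : 0 <= x < 1 -> psum (fun m => INR m * x ^ m) N <= x / (1 - x) ^ 2.
Proof.
  intros Hx. pose proof (sum_pow1_tail x N Hx).
  assert (0 <= x ^ N * (INR N * (x / (1 - x)) + x / (1 - x) ^ 2)); [|lra].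
  pose proof (pos_INR N).
  apply Rmult_le_pos; [apply pow_le; lra|].
  apply Rplus_le_le_0_compat; [apply Rmult_le_pos; [lra|]|];
    apply Rdiv_le_0_compat; try lra; apply pow_lt; lra.
Qed.

Lemma sum_pow2_le x N : 0 <= x < 1 ->
  psum (fun m => INR m ^ 2 * x ^ m) N <= x * (1 + x) / (1 - x) ^ 3.
Proof.
  intros Hx.
  (* [r N] is the sum of the terms beyond [N], found by expanding [(N + j) ^ 2] in powers of [j]. *)
  set (r := fun N => x ^ N * (INR N ^ 2 * (x / (1 - x)) + 2 * INR N * (x / (1 - x) ^ 2)
                              + x * (1 + x) / (1 - x) ^ 3)).
  assert (E : psum (fun m => INR m ^ 2 * x ^ m) N + r N = x * (1 + x) / (1 - x) ^ 3).
  { induction N as [|N IH]; [unfold r; simpl; field; lra|].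
    cbn [psum]. rewrite <- IH. unfold r. rewrite S_INR. simpl. field; lra. }
  assert (0 <= r N); [|lra].
  pose proof (pos_INR N). unfold r.
  apply Rmult_le_pos; [apply pow_le; lra|].
  repeat apply Rplus_le_le_0_compat.
  - apply Rmult_le_pos; [nra|apply Rdiv_le_0_compat; lra].
  - apply Rmult_le_pos; [nra|apply Rdiv_le_0_compat; [lra|apply pow_lt; lra]].
  - apply Rdiv_le_0_compat; [nra|apply pow_lt; lra].
Qed.

Lemma sum_pow3_le x N : 0 <= x < 1 ->
  psum (fun m => INR m ^ 3 * x ^ m) N <= x * (1 + 4 * x + x ^ 2) / (1 - x) ^ 4.
Proof.
  intros Hx.
  set (r := fun N => x ^ N * (INR N ^ 3 * (x / (1 - x)) + 3 * INR N ^ 2 * (x / (1 - x) ^ 2)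
      + 3 * INR N * (x * (1 + x) / (1 - x) ^ 3) + x * (1 + 4 * x + x ^ 2) / (1 - x) ^ 4)).
  assert (E : psum (fun m => INR m ^ 3 * x ^ m) N + r N = x * (1 + 4 * x + x ^ 2) / (1 - x) ^ 4).
  { induction N as [|N IH]; [unfold r; simpl; field; lra|].
    cbn [psum]. rewrite <- IH. unfold r. rewrite S_INR. simpl. field; lra. }
  assert (0 <= r N); [|lra].
  pose proof (pos_INR N). unfold r.
  apply Rmult_le_pos; [apply pow_le; lra|].
  assert (0 <= INR N ^ 2) by (apply pow_le; lra).
  assert (0 <= INR N ^ 3) by (apply pow_le; lra).
  repeat apply Rplus_le_le_0_compat.
  - apply Rmult_le_pos; [nra|apply Rdiv_le_0_compat; lra].
  - apply Rmult_le_pos; [nra|apply Rdiv_le_0_compat; [lra|apply pow_lt; lra]].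
  - apply Rmult_le_pos; [nra|apply Rdiv_le_0_compat; [nra|apply pow_lt; lra]].
  - apply Rdiv_le_0_compat; [nra|apply pow_lt; lra].
Qed.

(** * Elementary inequalities for exponential and hyperbolic functions *)

Lemma derive_nonneg_le (f df : R -> R) (a b : R) : a <= b ->
  (forall y, a <= y <= b -> is_derive f y (df y)) ->
  (forall y, a <= y <= b -> 0 <= df y) -> f a <= f b.
Proof.
  intros Hab Hd Hp.
  destruct (MVT_gen f a b df) as [c [Hc E]]; rewrite ?Rmin_left, ?Rmax_right in * by lra.
  - intros z Hz. apply Hd. lra.
  - intros z Hz. apply continuity_pt_filterlim, (ex_derive_continuous f z).
    eexists. apply Hd. lra.
  - assert (0 <= df c * (b - a)) by (apply Rmult_le_pos; [apply Hp|]; lra). lra.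
Qed.

Lemma exp_ge_taylor2 x : 0 <= x -> 1 + x + x ^ 2 / 2 <= exp x.
Proof.
  intros Hx.
  pose proof (derive_nonneg_le (fun y => exp y - 1 - y - y ^ 2 / 2)
    (fun y => exp y - 1 - y) 0 x Hx) as H.
  cbv beta in H. rewrite exp_0 in H.
  enough (1 - 1 - 0 - 0 ^ 2 / 2 <= exp x - 1 - x - x ^ 2 / 2) by lra.
  apply H.
  - intros z Hz. auto_derive; [trivial|field].
  - intros z Hz. pose proof (exp_ineq1_le z). lra.
Qed.

Lemma exp_ge_taylor3 x : 0 <= x -> 1 + x + x ^ 2 / 2 + x ^ 3 / 6 <= exp x.
Proof.
  intros Hx.
  pose proof (derive_nonneg_le (fun y => exp y - 1 - y - y ^ 2 / 2 - y ^ 3 / 6)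
    (fun y => exp y - 1 - y - y ^ 2 / 2) 0 x Hx) as H.
  cbv beta in H. rewrite exp_0 in H.
  enough (1 - 1 - 0 - 0 ^ 2 / 2 - 0 ^ 3 / 6 <= exp x - 1 - x - x ^ 2 / 2 - x ^ 3 / 6) by lra.
  apply H.
  - intros z Hz. auto_derive; [trivial|field].
  - intros z Hz. pose proof (exp_ge_taylor2 z). lra.
Qed.

Lemma exp_neg_lt1 y : 0 < y -> 0 < exp (- y) < 1.
Proof.
  intros Hy. split; [apply exp_pos|]. rewrite <- exp_0. apply exp_increasing. lra.
Qed.

Lemma exp_pow a m : exp a ^ m = exp (INR m * a).
Proof.
  induction m as [|m IH]; [simpl; rewrite Rmult_0_l, exp_0; reflexivity|].
  rewrite S_INR. simpl. rewrite IH, <- exp_plus. f_equal. ring.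
Qed.

Lemma le_2sinh y : 0 <= y -> y <= exp (y / 2) - exp (- (y / 2)).
Proof.
  intros Hy.
  pose proof (derive_nonneg_le (fun y => exp (y / 2) - exp (- (y / 2)) - y)
    (fun y => (exp (y / 2) + exp (- (y / 2))) / 2 - 1) 0 y Hy) as H.
  cbv beta in H. replace (0 / 2) with 0 in H by field. rewrite Ropp_0 in H.
  enough (exp 0 - exp 0 - 0 <= exp (y / 2) - exp (- (y / 2)) - y) by lra. apply H.
  - intros z Hz. auto_derive; [trivial|unfold Rdiv; field].
  - intros z Hz. rewrite exp_Ropp. pose proof (exp_pos (z / 2)).
    enough (0 <= (exp (z/2) - 1) ^ 2 / exp (z / 2) / 2) by
      (replace ((exp (z / 2) + / exp (z / 2)) / 2 - 1)
        with ((exp (z/2) - 1) ^ 2 / exp (z / 2) / 2) by (field; lra); assumption).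
    apply Rdiv_le_0_compat; [|lra]. apply Rdiv_le_0_compat; [apply pow2_ge_0|assumption].
Qed.

Lemma twocosh_le a : 0 <= a < 1 -> exp a + exp (- a) <= 2 / (1 - a ^ 2).
Proof.
  intros Ha.
  assert (H1 : exp a <= / (1 - a)).
  { rewrite <- (Ropp_involutive a) at 1. rewrite exp_Ropp.
    apply Rinv_le_contravar; [lra|]. pose proof (exp_ineq1_le (- a)). lra. }
  assert (H2 : exp (- a) <= / (1 + a)).
  { rewrite exp_Ropp. apply Rinv_le_contravar; [lra|]. apply exp_ineq1_le. }
  replace (2 / (1 - a ^ 2)) with (/ (1 - a) + / (1 + a)); [lra|].
  field. split; [|split]; nra.
Qed.

(** This is [tanh (y / 2) <= y / 2]; the difference of the two sides has derivative
    [y sinh (y / 2)]. *)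
Lemma sinh_le_cosh y : 0 <= y ->
  2 * (exp (y / 2) - exp (- (y / 2))) <= y * (exp (y / 2) + exp (- (y / 2))).
Proof.
  intros Hy.
  pose proof (derive_nonneg_le (fun y => y * (exp (y / 2) + exp (- (y / 2)))
     - 2 * (exp (y / 2) - exp (- (y / 2))))
    (fun y => y / 2 * (exp (y / 2) - exp (- (y / 2)))) 0 y Hy) as H.
  cbv beta in H. replace (0 / 2) with 0 in H by field. rewrite Ropp_0 in H.
  enough (0 * (exp 0 + exp 0) - 2 * (exp 0 - exp 0) <=
    y * (exp (y / 2) + exp (- (y / 2))) - 2 * (exp (y / 2) - exp (- (y / 2)))) by lra.
  apply H.
  - intros z Hz. auto_derive; [trivial|unfold Rdiv; field].
  - intros z Hz. apply Rmult_le_pos; [lra|]. pose proof (le_2sinh z). lra.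
Qed.

Lemma twosinh_le y : 0 <= y < 2 -> exp (y / 2) - exp (- (y / 2)) <= y / (1 - (y / 2) ^ 2).
Proof.
  intros Hy. pose proof (sinh_le_cosh y (proj1 Hy)) as H1.
  pose proof (twocosh_le (y / 2)).
  assert (H2 : y * (exp (y / 2) + exp (- (y / 2))) <= y * (2 / (1 - (y / 2) ^ 2))).
  { apply Rmult_le_compat_l; lra. }
  unfold Rdiv in *. lra.
Qed.

Lemma geo0_le y : 0 < y -> exp (- y) / (1 - exp (- y)) <= / y.
Proof.
  intros Hy. pose proof (exp_neg_lt1 y Hy) as Hx. set (x := exp (- y)) in *.
  assert (y * x <= 1 - x).
  { pose proof (exp_ineq1_le y).
    assert (E : x * exp y = 1) by (unfold x; rewrite <- exp_plus, <- exp_0; f_equal; ring).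
    nra. }
  apply (Rmult_le_reg_r (y * (1 - x))); [apply Rmult_lt_0_compat; lra|].
  replace (x / (1 - x) * (y * (1 - x))) with (y * x) by (field; lra).
  replace (/ y * (y * (1 - x))) with (1 - x) by (field; lra). assumption.
Qed.

(** As [1 - exp (- y) = 2 exp (- y / 2) sinh (y / 2)], this is [sinh (y / 2) >= y / 2]. In the
    closed forms below the powers of [exp (- y / 2)] cancel; what remains has hyperbolic cosines
    over powers of [2 sinh (y / 2)], and only the denominators are estimated. *)
Lemma one_minus_exp_ge y : 0 <= y -> y * exp (- (y / 2)) <= 1 - exp (- y).
Proof.
  intros Hy. pose proof (le_2sinh y Hy) as H.
  assert (E1 : exp (- y) = exp (- (y / 2)) * exp (- (y / 2)))
    by (rewrite <- exp_plus; f_equal; field).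
  assert (E2 : 1 = exp (y / 2) * exp (- (y / 2)))
    by (rewrite <- exp_plus, <- exp_0; f_equal; ring).
  rewrite E1. rewrite E2 at 1. pose proof (exp_pos (- (y / 2))). nra.
Qed.

Lemma div_le_div a b c d : 0 < b -> 0 < d -> a * d <= c * b -> a / b <= c / d.
Proof.
  intros Hb Hd H. apply (Rmult_le_reg_r (b * d)); [apply Rmult_lt_0_compat; lra|].
  replace (a / b * (b * d)) with (a * d) by (field; lra).
  replace (c / d * (b * d)) with (c * b) by (field; lra). assumption.
Qed.

Lemma pow_one_minus_exp_ge y k : 0 < y ->
  (y ^ k * exp (- (y / 2)) ^ k) <= (1 - exp (- y)) ^ k.
Proof.
  intros Hy. rewrite <- Rpow_mult_distr. apply pow_incr. split.
  - apply Rmult_le_pos; [lra|left; apply exp_pos].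
  - apply one_minus_exp_ge; lra.
Qed.

Lemma geo1_le y : 0 < y -> exp (- y) / (1 - exp (- y)) ^ 2 <= / y ^ 2.
Proof.
  intros Hy. pose proof (exp_neg_lt1 y Hy) as Hx.
  pose proof (pow_one_minus_exp_ge y 2 Hy) as H.
  replace (exp (- (y / 2)) ^ 2) with (exp (- y)) in H by (rewrite exp_pow; f_equal; simpl; field).
  replace (/ y ^ 2) with (1 / y ^ 2) by (unfold Rdiv; ring).
  apply div_le_div; try (apply pow_lt; lra). lra.
Qed.

Lemma geo2_le y : 0 < y ->
  exp (- y) * (1 + exp (- y)) / (1 - exp (- y)) ^ 3 <= (exp (y / 2) + exp (- (y / 2))) / y ^ 3.
Proof.
  intros Hy. pose proof (exp_neg_lt1 y Hy) as Hx.
  pose proof (pow_one_minus_exp_ge y 3 Hy) as H.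
  apply div_le_div; try (apply pow_lt; lra).
  apply Rle_trans with ((exp (y / 2) + exp (- (y / 2))) * (y ^ 3 * exp (- (y / 2)) ^ 3)).
  - right.
    assert (E1 : exp (- y) = exp (- (y / 2)) ^ 2) by (rewrite exp_pow; f_equal; simpl; field).
    assert (E2 : exp (y / 2) * exp (- (y / 2)) = 1)
      by (rewrite <- exp_plus, <- exp_0; f_equal; ring).
    rewrite E1. set (z := exp (- (y / 2))) in *.
    replace ((exp (y / 2) + z) * (y ^ 3 * z ^ 3))
      with (y ^ 3 * z ^ 2 * (exp (y / 2) * z + z ^ 2)) by ring.
    rewrite E2. ring.
  - apply Rmult_le_compat_l; [|exact H].
    pose proof (exp_pos (y / 2)); pose proof (exp_pos (- (y / 2))); lra.
Qed.

Lemma geo3_le y : 0 < y ->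
  exp (- y) * (1 + 4 * exp (- y) + exp (- y) ^ 2) / (1 - exp (- y)) ^ 4
  <= (exp y + 4 + exp (- y)) / y ^ 4.
Proof.
  intros Hy. pose proof (exp_neg_lt1 y Hy) as Hx.
  pose proof (pow_one_minus_exp_ge y 4 Hy) as H.
  apply div_le_div; try (apply pow_lt; lra).
  apply Rle_trans with ((exp y + 4 + exp (- y)) * (y ^ 4 * exp (- (y / 2)) ^ 4)).
  - right.
    assert (E1 : exp (- (y / 2)) ^ 4 = exp (- y) ^ 2) by (rewrite !exp_pow; f_equal; simpl; field).
    assert (E2 : exp y * exp (- y) = 1)
      by (rewrite <- exp_plus, <- exp_0; f_equal; ring).
    rewrite E1. set (x := exp (- y)) in *.
    replace ((exp y + 4 + x) * (y ^ 4 * x ^ 2))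
      with (y ^ 4 * x * (exp y * x + 4 * x + x ^ 2)) by ring.
    rewrite E2. ring.
  - apply Rmult_le_compat_l; [|exact H].
    pose proof (exp_pos y); lra.
Qed.

Lemma geo_sum_le y N : 0 < y -> psum (fun m => exp (- (INR m * y))) N <= / y.
Proof.
  intros Hy. pose proof (exp_neg_lt1 y Hy) as Hx.
  apply Rle_trans with (exp (- y) / (1 - exp (- y))); [|apply geo0_le; lra].
  rewrite (psum_ext _ (fun m => exp (- y) ^ m)).
  - apply sum_pow0_le. lra.
  - intros m _. rewrite exp_pow. f_equal. ring.
Qed.

Lemma geo_sum1_le y N : 0 < y -> psum (fun m => INR m * exp (- (INR m * y))) N <= / y ^ 2.
Proof.
  intros Hy. pose proof (exp_neg_lt1 y Hy) as Hx.
  apply Rle_trans with (exp (- y) / (1 - exp (- y)) ^ 2); [|apply geo1_le; lra].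
  rewrite (psum_ext _ (fun m => INR m * exp (- y) ^ m)).
  - apply sum_pow1_le. lra.
  - intros m _. rewrite exp_pow. do 2 f_equal. ring.
Qed.

Lemma geo_sum2_le y N : 0 < y -> psum (fun m => INR m ^ 2 * exp (- (INR m * y))) N
  <= (exp (y / 2) + exp (- (y / 2))) / y ^ 3.
Proof.
  intros Hy. pose proof (exp_neg_lt1 y Hy) as Hx.
  eapply Rle_trans; [|apply geo2_le; lra].
  rewrite (psum_ext _ (fun m => INR m ^ 2 * exp (- y) ^ m)).
  - apply sum_pow2_le. lra.
  - intros m _. rewrite exp_pow. do 2 f_equal. ring.
Qed.

Lemma geo_sum3_le y N : 0 < y -> psum (fun m => INR m ^ 3 * exp (- (INR m * y))) N
  <= (exp y + 4 + exp (- y)) / y ^ 4.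
Proof.
  intros Hy. pose proof (exp_neg_lt1 y Hy) as Hx.
  eapply Rle_trans; [|apply geo3_le; lra].
  rewrite (psum_ext _ (fun m => INR m ^ 3 * exp (- y) ^ m)).
  - apply sum_pow3_le. lra.
  - intros m _. rewrite exp_pow. do 2 f_equal. ring.
Qed.

(** * Mean, variance and third cumulant *)

Definition rho (t : R) (m : nat) : R := exp (- (INR m * t)).

(** This and the next two are the first three derivatives in [- t] of the logarithm of
    [prod_(m <= N) 1 / (1 - exp (- m t))]: the cumulants of the size of a random partition weighted
    by [exp (- t size)]. *)
Definition mean (t : R) (N : nat) : R :=
  psum (fun m => INR m * (rho t m / (1 - rho t m))) N.
Definition variance (t : R) (N : nat) : R :=
  psum (fun m => INR m ^ 2 * (rho t m / (1 - rho t m) ^ 2)) N.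
Definition cumulant3 (t : R) (N : nat) : R :=
  psum (fun m => INR m ^ 3 * (rho t m * (1 + rho t m) / (1 - rho t m) ^ 3)) N.

Lemma INR_ge1 m : (1 <= m)%nat -> 1 <= INR m.
Proof. intros H. apply (le_INR 1 m H). Qed.

Lemma rho_bounds t m : 0 < t -> (1 <= m)%nat -> 0 < rho t m < 1.
Proof.
  intros Ht Hm. apply exp_neg_lt1. apply Rmult_lt_0_compat; [|lra].
  pose proof (INR_ge1 m Hm). lra.
Qed.

Lemma rho_pow t m k : rho t m ^ k = exp (- (INR m * (INR k * t))).
Proof. unfold rho. rewrite exp_pow. f_equal. ring. Qed.

Lemma rho_geo0 t m : 0 < t -> (1 <= m)%nat ->
  INR m * (rho t m / (1 - rho t m)) <= / t.
Proof.
  intros Ht Hm. pose proof (INR_ge1 m Hm).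
  assert (Hy : 0 < INR m * t) by nra.
  pose proof (geo0_le (INR m * t) Hy) as H0. fold (rho t m) in H0.
  apply Rle_trans with (INR m * / (INR m * t)).
  - apply Rmult_le_compat_l; lra.
  - right. field. lra.
Qed.

Lemma rho_geo1 t m : 0 < t -> (1 <= m)%nat ->
  INR m ^ 2 * (rho t m / (1 - rho t m) ^ 2) <= / t ^ 2.
Proof.
  intros Ht Hm. pose proof (INR_ge1 m Hm).
  assert (Hy : 0 < INR m * t) by nra.
  pose proof (geo1_le (INR m * t) Hy) as H0. fold (rho t m) in H0.
  apply Rle_trans with (INR m ^ 2 * / (INR m * t) ^ 2).
  - apply Rmult_le_compat_l; [apply pow_le|]; lra.
  - right. field. lra.
Qed.

Lemma rho_geo2 t m : 0 < t -> (1 <= m)%nat ->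
  INR m ^ 3 * (rho t m * (1 + rho t m) / (1 - rho t m) ^ 3)
  <= (exp (INR m * t / 2) + exp (- (INR m * t / 2))) / t ^ 3.
Proof.
  intros Ht Hm. pose proof (INR_ge1 m Hm).
  assert (Hy : 0 < INR m * t) by nra.
  pose proof (geo2_le (INR m * t) Hy) as H0. fold (rho t m) in H0.
  eapply Rle_trans; [apply Rmult_le_compat_l; [apply pow_le; lra|exact H0]|].
  right. field. lra.
Qed.

(** Expand [rho / (1 - rho)] in powers of [rho] and sum over [m] first: the power [k] gives at most
    [1 / (k t) ^ 2]. The powers beyond [K] together cost [/ INR K], a substitute for the tail of
    [zeta(2)]. *)
Lemma mean_le K t N : (1 <= K)%nat -> 0 < t ->
  mean t N <= (psum (fun k => / INR k ^ 2) K + / INR K) / t ^ 2.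
Proof.
  intros HK Ht. pose proof (INR_ge1 K HK) as HK'.
  apply Rle_trans with (psum (fun m => psum (fun k => INR m * exp (- (INR m * (INR k * t)))) K
    + / t * exp (- (INR m * (INR K * t)))) N).
  - apply psum_le. intros m Hm.
    pose proof (rho_bounds t m Ht (proj1 Hm)) as Hr.
    pose proof (rho_geo0 t m Ht (proj1 Hm)) as H0.
    rewrite <- (sum_pow0_tail (rho t m) K) by lra.
    rewrite Rmult_plus_distr_l, <- psum_scal.
    apply Rplus_le_compat.
    + right. apply psum_ext. intros k _. rewrite rho_pow. reflexivity.
    + rewrite rho_pow. pose proof (exp_pos (- (INR m * (INR K * t)))). nra.
  - rewrite psum_plus, psum_swap, psum_scal.
    replace ((psum (fun k => / INR k ^ 2) K + / INR K) / t ^ 2)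
      with (psum (fun k => / t ^ 2 * / INR k ^ 2) K + / t * / (INR K * t))
      by (rewrite psum_scal; field; lra).
    apply Rplus_le_compat.
    + apply psum_le. intros k Hk. pose proof (INR_ge1 k (proj1 Hk)).
      replace (/ t ^ 2 * / INR k ^ 2) with (/ (INR k * t) ^ 2) by (field; lra).
      apply geo_sum1_le. nra.
    + apply Rmult_le_compat_l; [left; apply Rinv_0_lt_compat; lra|].
      apply geo_sum_le. nra.
Qed.

(** The same expansion; the power [k] now gives at most [2 cosh (k t / 2) / (k ^ 2 t ^ 3)], whence
    the constant [c]. Beyond [K] the pointwise bounds [rho_geo0] and [rho_geo1] suffice. *)
Lemma variance_le K c t N : (1 <= K)%nat -> 0 < t ->
  (forall k, (1 <= k <= K)%nat -> exp (INR k * t / 2) + exp (- (INR k * t / 2)) <= 2 * c) ->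
  variance t N <= 2 * (c * psum (fun k => / INR k ^ 2) K + / INR K) / t ^ 3.
Proof.
  intros HK Ht Hc. pose proof (INR_ge1 K HK) as HK'.
  apply Rle_trans with
    (psum (fun m => psum (fun k => INR k * (INR m ^ 2 * exp (- (INR m * (INR k * t))))) K
    + (INR K / t * (INR m * exp (- (INR m * (INR K * t))))
    + / t ^ 2 * exp (- (INR m * (INR K * t))))) N).
  - apply psum_le. intros m Hm.
    pose proof (rho_bounds t m Ht (proj1 Hm)) as Hr.
    pose proof (rho_geo0 t m Ht (proj1 Hm)) as H0.
    pose proof (rho_geo1 t m Ht (proj1 Hm)) as H1.
    pose proof (INR_ge1 m (proj1 Hm)) as Hm'.
    rewrite <- (sum_pow1_tail (rho t m) K) by lra.
    rewrite Rmult_plus_distr_l, <- psum_scal.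
    apply Rplus_le_compat.
    + right. apply psum_ext. intros k _. rewrite rho_pow. ring.
    + rewrite rho_pow. pose proof (exp_pos (- (INR m * (INR K * t)))).
      set (e := exp (- (INR m * (INR K * t)))) in *.
      replace (INR m ^ 2 * (e * (INR K * (rho t m / (1 - rho t m)) + rho t m / (1 - rho t m) ^ 2)))
       with ((INR K * INR m * e) * (INR m * (rho t m / (1 - rho t m)))
              + e * (INR m ^ 2 * (rho t m / (1 - rho t m) ^ 2))) by ring.
      apply Rplus_le_compat.
      * replace (INR K / t * (INR m * e)) with ((INR K * INR m * e) * / t) by (field; lra).
        apply Rmult_le_compat_l; [|lra]. repeat apply Rmult_le_pos; lra.
      * rewrite Rmult_comm. apply Rmult_le_compat_r; lra.
  - rewrite !psum_plus, psum_swap, !psum_scal.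
    replace (2 * (c * psum (fun k => / INR k ^ 2) K + / INR K) / t ^ 3)
      with (psum (fun k => 2 * c / t ^ 3 * / INR k ^ 2) K
        + (INR K / t * / (INR K * t) ^ 2 + / t ^ 2 * / (INR K * t)))
      by (rewrite psum_scal; field; lra).
    apply Rplus_le_compat; [|apply Rplus_le_compat].
    + apply psum_le. intros k Hk. pose proof (INR_ge1 k (proj1 Hk)).
      rewrite psum_scal.
      assert (Hy : 0 < INR k * t) by nra.
      pose proof (geo_sum2_le (INR k * t) N Hy) as H1. pose proof (Hc k Hk) as H2.
      apply Rle_trans with (INR k * (2 * c / (INR k * t) ^ 3)).
      * apply Rmult_le_compat_l; [lra|]. eapply Rle_trans; [exact H1|].
        apply Rmult_le_compat_r; [|exact H2].
        left. apply Rinv_0_lt_compat, pow_lt, Hy.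
      * right. field. lra.
    + apply Rmult_le_compat_l; [apply Rdiv_le_0_compat; lra|].
      apply geo_sum1_le. nra.
    + apply Rmult_le_compat_l; [left; apply Rinv_0_lt_compat, pow_lt; lra|].
      apply geo_sum_le. nra.
Qed.

Lemma cumulant3_le t N : 0 < t <= 288 / 10000 -> cumulant3 t N <= 1267 / 100 / t ^ 4.
Proof.
  intros Ht.
  apply Rle_trans with
    (psum (fun m => INR m ^ 3 * exp (- (INR m * t)) + (/ t * (INR m ^ 2 * exp (- (INR m * t)))
     + (2 / t ^ 2 * (INR m * exp (- (INR m * t)))
     + (/ t ^ 3 * exp (- (INR m * (t / 2))) + / t ^ 3 * exp (- (INR m * (3 * t / 2)))))) ) N).
  - apply psum_le. intros m Hm.
    pose proof (rho_bounds t m (proj1 Ht) (proj1 Hm)) as Hr.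
    pose proof (rho_geo0 t m (proj1 Ht) (proj1 Hm)) as H0.
    pose proof (rho_geo1 t m (proj1 Ht) (proj1 Hm)) as H1.
    pose proof (rho_geo2 t m (proj1 Ht) (proj1 Hm)) as H2.
    pose proof (INR_ge1 m (proj1 Hm)) as Hm'.
    fold (rho t m).
    replace (/ t ^ 3 * exp (- (INR m * (t / 2))) + / t ^ 3 * exp (- (INR m * (3 * t / 2))))
      with (rho t m * ((exp (INR m * t / 2) + exp (- (INR m * t / 2))) / t ^ 3)).
    2:{ unfold rho.
        replace (exp (- (INR m * t)) * ((exp (INR m * t / 2) + exp (- (INR m * t / 2))) / t ^ 3))
        with (/ t ^ 3 * (exp (- (INR m * t)) * exp (INR m * t / 2))
            + / t ^ 3 * (exp (- (INR m * t)) * exp (- (INR m * t / 2)))) by (field; lra).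
        rewrite <- !exp_plus. f_equal; do 2 f_equal; field. }
    set (r := rho t m) in *. set (y := INR m) in *.
    (* Peels the first term off [sum k ^ 2 r ^ k] and uses [(k + 1) ^ 2 = k ^ 2 + 2 k + 1]; the rest
       gains a factor [r], which keeps the sum over [m] bounded after the pointwise estimates. *)
    replace (y ^ 3 * (r * (1 + r) / (1 - r) ^ 3))
      with (y ^ 3 * r + (y ^ 2 * r * (y * (r / (1 - r))) + (2 * y * r * (y ^ 2 * (r / (1 - r) ^ 2))
         + r * (y ^ 3 * (r * (1 + r) / (1 - r) ^ 3))))) by (field; lra).
    apply Rplus_le_compat_l. apply Rplus_le_compat; [|apply Rplus_le_compat].
    + rewrite (Rmult_comm (/ t)). apply Rmult_le_compat_l; [|exact H0].
      apply Rmult_le_pos; [apply pow_le|]; lra.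
    + replace (2 / t ^ 2 * (y * r)) with (2 * y * r * / t ^ 2) by (field; lra).
      apply Rmult_le_compat_l; [nra|exact H1].
    + apply Rmult_le_compat_l; [lra|exact H2].
  - rewrite !psum_plus, !psum_scal.
    pose proof (geo_sum3_le t N (proj1 Ht)) as S3.
    pose proof (geo_sum2_le t N (proj1 Ht)) as S2.
    pose proof (geo_sum1_le t N (proj1 Ht)) as S1.
    pose proof (geo_sum_le (t / 2) N ltac:(lra)) as S0.
    pose proof (geo_sum_le (3 * t / 2) N ltac:(lra)) as S0'.
    assert (C1 : exp t + exp (- t) <= 2002 / 1000).
    { eapply Rle_trans; [apply twocosh_le; lra|].
      apply (Rmult_le_reg_r (1 - t ^ 2)); [nra|]. unfold Rdiv.
      rewrite Rmult_assoc, Rinv_l by nra. nra. }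
    assert (C2 : exp (t / 2) + exp (- (t / 2)) <= 2001 / 1000).
    { eapply Rle_trans; [apply twocosh_le; lra|].
      apply (Rmult_le_reg_r (1 - (t / 2) ^ 2)); [nra|]. unfold Rdiv.
      rewrite Rmult_assoc, Rinv_l by nra. nra. }
    assert (P : forall k, 0 < / t ^ k) by (intros k; apply Rinv_0_lt_compat, pow_lt; lra).
    assert (P1 : 0 < / t) by (apply Rinv_0_lt_compat; lra).
    assert (Q3 : (exp t + 4 + exp (- t)) / t ^ 4 <= (6002 / 1000) / t ^ 4).
    { apply Rmult_le_compat_r; [left; apply P|lra]. }
    assert (Q2 : / t * psum (fun m => INR m ^ 2 * exp (- (INR m * t))) N
                 <= (2001 / 1000) / t ^ 4).
    { apply Rle_trans with (/ t * ((2001 / 1000) / t ^ 3)).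
      - apply Rmult_le_compat_l; [lra|]. eapply Rle_trans; [exact S2|].
        apply Rmult_le_compat_r; [left; apply P|lra].
      - right. field. lra. }
    assert (Q1 : 2 / t ^ 2 * psum (fun m => INR m * exp (- (INR m * t))) N <= 2 / t ^ 4).
    { apply Rle_trans with (2 / t ^ 2 * / t ^ 2).
      - apply Rmult_le_compat_l; [|exact S1]. pose proof (P 2%nat). unfold Rdiv. lra.
      - right. field. lra. }
    assert (Q0 : / t ^ 3 * psum (fun m => exp (- (INR m * (t / 2)))) N <= 2 / t ^ 4).
    { apply Rle_trans with (/ t ^ 3 * / (t / 2)).
      - apply Rmult_le_compat_l; [left; apply P|exact S0].
      - right. field. lra. }
    assert (Q0' : / t ^ 3 * psum (fun m => exp (- (INR m * (3 * t / 2)))) N <= (2 / 3) / t ^ 4).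
    { apply Rle_trans with (/ t ^ 3 * / (3 * t / 2)).
      - apply Rmult_le_compat_l; [left; apply P|exact S0'].
      - right. field. lra. }
    (* The constant is [6.002 + 2.001 + 2 + 2 + 2/3], just below 12.67. *)
    pose proof (P 4%nat). unfold Rdiv in *. lra.
Qed.

(** * Modulus and argument of the generating function *)

Fixpoint pprod (f : nat -> R) (N : nat) : R :=
  match N with O => 1 | S N' => pprod f N' * f N end.

(* [|1 - r exp (i a)|^2] *)
Definition sqdist (r a : R) : R := 1 - 2 * r * cos a + r ^ 2.

(* Modulus, normalised to [1] at [theta = 0], and argument of the generating
   function [prod_(m <= N) 1 / (1 - z^m)] at [z = exp (- t + i theta)]. *)
Definition modulus (t : R) (N : nat) (theta : R) : R :=
  pprod (fun m => (1 - rho t m) / sqrt (sqdist (rho t m) (INR m * theta))) N.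
Definition phase (t : R) (N : nat) (theta : R) : R :=
  psum (fun m => atan (rho t m * sin (INR m * theta) / (1 - rho t m * cos (INR m * theta)))) N.

Lemma one_minus_cos_le a : 1 - cos a <= a ^ 2 / 2.
Proof.
  assert (H : forall a, 0 <= a -> 1 - cos a <= a ^ 2 / 2).
  { intros b Hb.
    pose proof (derive_nonneg_le (fun y => y ^ 2 / 2 + cos y) (fun y => y - sin y) 0 b Hb) as H.
    cbv beta in H. rewrite cos_0 in H.
    enough (0 ^ 2 / 2 + 1 <= b ^ 2 / 2 + cos b) by lra. apply H.
    - intros z Hz. auto_derive; [trivial|field].
    - intros z Hz. destruct (Req_dec z 0) as [->|].
      + rewrite sin_0. lra.
      + pose proof (sin_lt_x z). lra. }
  destruct (Rle_dec 0 a); [apply H; lra|].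
  rewrite <- cos_neg. replace (a ^ 2) with ((- a) ^ 2) by ring. apply H. lra.
Qed.

Lemma one_minus_cos_ge a : a ^ 2 / 2 * (1 - a ^ 2 / 12) <= 1 - cos a.
Proof.
  assert (H : forall a, 0 <= a -> a ^ 2 / 2 * (1 - a ^ 2 / 12) <= 1 - cos a).
  { intros b Hb.
    assert (Hs : forall z, 0 <= z -> z - z ^ 3 / 6 <= sin z).
    { intros z Hz.
      pose proof (derive_nonneg_le (fun y => sin y - y + y ^ 3 / 6)
        (fun y => cos y - 1 + y ^ 2 / 2) 0 z Hz) as H.
      cbv beta in H. rewrite sin_0 in H.
      enough (0 - 0 + 0 ^ 3 / 6 <= sin z - z + z ^ 3 / 6) by lra. apply H.
      - intros w Hw. auto_derive; [trivial|field].
      - intros w Hw. pose proof (one_minus_cos_le w). lra. }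
    pose proof (derive_nonneg_le (fun y => - cos y - y ^ 2 / 2 + y ^ 4 / 24)
      (fun y => sin y - y + y ^ 3 / 6) 0 b Hb) as H.
    cbv beta in H. rewrite cos_0 in H.
    enough (- 1 - 0 ^ 2 / 2 + 0 ^ 4 / 24 <= - cos b - b ^ 2 / 2 + b ^ 4 / 24) by lra. apply H.
    - intros w Hw. auto_derive; [trivial|field].
    - intros w Hw. pose proof (Hs w). lra. }
  destruct (Rle_dec 0 a); [apply H; lra|].
  rewrite <- cos_neg. replace (a ^ 2) with ((- a) ^ 2) by ring. apply H. lra.
Qed.

Lemma sqdist_ge r a : 0 <= r -> (1 - r) ^ 2 <= sqdist r a.
Proof.
  intros Hr. unfold sqdist. pose proof (COS_bound a). nra.
Qed.

Lemma sqdist_pos r a : 0 <= r < 1 -> 0 < sqdist r a.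
Proof.
  intros Hr. pose proof (sqdist_ge r a (proj1 Hr)).
  assert (0 < (1 - r) ^ 2) by (apply pow_lt; lra). lra.
Qed.

Lemma factor_pos r a : 0 <= r < 1 -> 0 < (1 - r) / sqrt (sqdist r a).
Proof.
  intros Hr. apply Rdiv_lt_0_compat; [lra|]. apply sqrt_lt_R0, sqdist_pos, Hr.
Qed.

(** [sqdist r a / (1 - r) ^ 2 = 1 + 2 r (1 - cos a) / (1 - r) ^ 2], and [1 + x <= exp x] applies
    after [1 - cos a <= a ^ 2 / 2]. *)
Lemma factor_ge r a : 0 <= r < 1 ->
  exp (- (r / (1 - r) ^ 2 * a ^ 2 / 2)) <= (1 - r) / sqrt (sqdist r a).
Proof.
  intros Hr. set (b := r / (1 - r) ^ 2 * a ^ 2 / 2).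
  assert (H : sqrt (sqdist r a) <= (1 - r) * exp b).
  { apply Rsqr_incr_0_var; [|apply Rmult_le_pos; [lra|left; apply exp_pos]].
    rewrite Rsqr_sqrt by (left; apply sqdist_pos, Hr).
    unfold Rsqr. replace ((1 - r) * exp b * ((1 - r) * exp b)) with ((1 - r) ^ 2 * (exp b * exp b)) by ring.
    rewrite <- exp_plus.
    apply Rle_trans with ((1 - r) ^ 2 * (1 + (b + b))).
    - unfold sqdist, b. pose proof (one_minus_cos_le a).
      replace ((1 - r) ^ 2 * (1 + (r / (1 - r) ^ 2 * a ^ 2 / 2 + r / (1 - r) ^ 2 * a ^ 2 / 2)))
        with ((1 - r) ^ 2 + r * a ^ 2) by (field; lra). nra.
    - apply Rmult_le_compat_l; [apply pow2_ge_0|]. apply exp_ineq1_le. }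
  rewrite exp_Ropp. pose proof (exp_pos b).
  assert (0 < sqrt (sqdist r a)) by (apply sqrt_lt_R0, sqdist_pos, Hr).
  apply (Rmult_le_reg_r (exp b * sqrt (sqdist r a))); [apply Rmult_lt_0_compat; lra|].
  replace (/ exp b * (exp b * sqrt (sqdist r a))) with (sqrt (sqdist r a)) by (field; lra).
  replace ((1 - r) / sqrt (sqdist r a) * (exp b * sqrt (sqdist r a))) with ((1 - r) * exp b)
    by (field; lra). exact H.
Qed.

(* [sqdist r phi = |1 - r exp (i phi)|^2] and the numerator is
   the real part of a number of modulus [|1 - r exp (i phi)|]. *)
Lemma shifted_cos_le r phi b : 0 <= r < 1 ->
  Rabs (cos (b + phi) - r * cos b) / sqdist r phi <= / (1 - r).
Proof.
  intros Hr. pose proof (sqdist_ge r phi (proj1 Hr)) as Hd.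
  pose proof (sqdist_pos r phi Hr) as Hp.
  set (d := sqdist r phi) in *. set (w := cos (b + phi) - r * cos b).
  assert (Hw : w ^ 2 <= d).
  { assert (E : w ^ 2 + (sin (b + phi) - r * sin b) ^ 2 = d).
    { unfold w, d, sqdist.
      replace (cos phi) with (cos (b + phi) * cos b + sin (b + phi) * sin b).
      2:{ rewrite <- cos_minus. f_equal. ring. }
      pose proof (sin2_cos2 b). pose proof (sin2_cos2 (b + phi)). unfold Rsqr in *. nra. }
    pose proof (pow2_ge_0 (sin (b + phi) - r * sin b)). lra. }
  replace (/ (1 - r)) with (1 / (1 - r)) by (unfold Rdiv; ring).
  apply div_le_div; [exact Hp|lra|]. rewrite Rmult_1_l.
  apply Rsqr_incr_0_var; [|lra].
  unfold Rsqr. replace (Rabs w * (1 - r) * (Rabs w * (1 - r))) with (Rabs w ^ 2 * (1 - r) ^ 2) by ring.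
  rewrite pow2_abs. apply Rmult_le_compat; try apply pow2_ge_0; assumption.
Qed.

(** The right-hand side is the series [sum_k r ^ k (1 - cos (k a)) / k] of nonnegative terms, of
    which three are kept. The derivative in [r] of the dropped part is a geometric series; its
    closed form is nonnegative by [shifted_cos_le]. *)
Lemma log_factor_ge r a : 0 <= r < 1 ->
  r * (1 - cos a) + r ^ 2 * (1 - cos (2 * a)) / 2 + r ^ 3 * (1 - cos (3 * a)) / 3
  <= ln (sqdist r a) / 2 - ln (1 - r).
Proof.
  intros Hr.
  pose proof (derive_nonneg_le (fun r => ln (sqdist r a) / 2 - ln (1 - r)
     - (r * (1 - cos a) + r ^ 2 * (1 - cos (2 * a)) / 2 + r ^ 3 * (1 - cos (3 * a)) / 3))
     (fun r => r ^ 3 * (/ (1 - r) - (cos (3 * a + a) - r * cos (3 * a)) / sqdist r a))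
     0 r (proj1 Hr)) as H.
  cbv beta in H.
  assert (E0 : sqdist 0 a = 1) by (unfold sqdist; ring).
  rewrite E0, Rminus_0_r, ln_1 in H.
  enough (0 / 2 - 0 - (0 * (1 - cos a) + 0 ^ 2 * (1 - cos (2 * a)) / 2 +
    0 ^ 3 * (1 - cos (3 * a)) / 3) <= ln (sqdist r a) / 2 - ln (1 - r) -
    (r * (1 - cos a) + r ^ 2 * (1 - cos (2 * a)) / 2 + r ^ 3 * (1 - cos (3 * a)) / 3)) by lra.
  apply H.
  - intros z Hz. assert (Hz' : 0 <= z < 1) by lra.
    pose proof (sqdist_pos z a Hz') as Hp.
    unfold sqdist in *.
    auto_derive; [split; [|split]; lra|].
    assert (C2 : cos (2 * a) = 2 * cos a ^ 2 - 1).
    { rewrite cos_2a_cos. ring. }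
    assert (C3 : cos (3 * a) = 4 * cos a ^ 3 - 3 * cos a).
    { replace (3 * a) with (2 * a + a) by ring. rewrite cos_plus, sin_2a, C2.
      pose proof (sin2_cos2 a) as E. unfold Rsqr in E.
      replace (2 * sin a * cos a * sin a) with (2 * (sin a * sin a) * cos a) by ring.
      replace (sin a * sin a) with (1 - cos a * cos a) by lra. ring. }
    assert (C4 : cos (3 * a + a) = 8 * cos a ^ 4 - 8 * cos a ^ 2 + 1).
    { replace (3 * a + a) with (2 * (2 * a)) by ring. rewrite cos_2a_cos, C2. ring. }
    rewrite C4, C3, C2. field. split; lra.
  - intros z Hz. assert (Hz' : 0 <= z < 1) by lra.
    apply Rmult_le_pos; [apply pow_le; lra|].
    pose proof (shifted_cos_le z a (3 * a) Hz') as H1.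
    pose proof (sqdist_pos z a Hz') as Hp.
    assert ((cos (3 * a + a) - z * cos (3 * a)) / sqdist z a
      <= Rabs (cos (3 * a + a) - z * cos (3 * a)) / sqdist z a); [|lra].
    apply Rmult_le_compat_r; [left; apply Rinv_0_lt_compat, Hp|apply Rle_abs].
Qed.

Lemma exp_le_compat a b : a <= b -> exp a <= exp b.
Proof. intros [H|H]; [left; apply exp_increasing, H|right; f_equal; exact H]. Qed.

Lemma factor_le r a : 0 <= r < 1 ->
  (1 - r) / sqrt (sqdist r a) <=
  exp (- (r * (1 - cos a) + r ^ 2 * (1 - cos (2 * a)) / 2 + r ^ 3 * (1 - cos (3 * a)) / 3)).
Proof.
  intros Hr. pose proof (log_factor_ge r a Hr) as H.
  rewrite <- (exp_ln ((1 - r) / sqrt (sqdist r a))) by (apply factor_pos, Hr).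
  apply exp_le_compat.
  pose proof (sqdist_pos r a Hr) as Hp.
  rewrite ln_div by (try apply sqrt_lt_R0; lra).
  pose proof (sqrt_lt_R0 _ Hp) as Hs.
  rewrite <- (sqrt_sqrt (sqdist r a)) in H by lra.
  rewrite ln_mult in H by lra. lra.
Qed.

(* The sum of [x^m (1 - cos (m phi))] over all [m >= 1]. *)
Definition cosgap (x phi : R) : R :=
  x * (1 + x) * (1 - cos phi) / ((1 - x) * ((1 - x) ^ 2 + 2 * x * (1 - cos phi))).

Lemma cosgap_den_pos x phi : 0 <= x < 1 -> 0 < (1 - x) ^ 2 + 2 * x * (1 - cos phi).
Proof.
  intros Hx. pose proof (COS_bound phi). assert (0 < (1 - x) ^ 2) by (apply pow_lt; lra). nra.
Qed.

Lemma cosgap_nonneg x phi : 0 <= x < 1 -> 0 <= cosgap x phi.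
Proof.
  intros Hx. pose proof (cosgap_den_pos x phi Hx). pose proof (COS_bound phi).
  unfold cosgap. apply Rdiv_le_0_compat; [|apply Rmult_lt_0_compat; lra].
  repeat apply Rmult_le_pos; lra.
Qed.

Lemma sum_cosgap_tail x phi N : 0 <= x < 1 ->
  psum (fun m => x ^ m * (1 - cos (INR m * phi))) N
  + x ^ N * (x * (/ (1 - x) - (cos (INR N * phi + phi) - x * cos (INR N * phi)) / sqdist x phi))
  = cosgap x phi.
Proof.
  intros Hx. pose proof (sqdist_pos x phi Hx) as Hd. pose proof (cosgap_den_pos x phi Hx) as Hd'.
  induction N as [|N IH].
  - simpl. rewrite Rmult_0_l, !Rplus_0_l, cos_0. unfold cosgap, sqdist in *. field.
    repeat split; lra.
  - rewrite <- IH. cbn [psum]. rewrite S_INR.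
    replace ((INR N + 1) * phi) with (INR N * phi + phi) by ring.
    replace (cos (INR N * phi + phi + phi))
      with (2 * cos phi * cos (INR N * phi + phi) - cos (INR N * phi)).
    + unfold sqdist in *. simpl. field. split; lra.
    + set (u := INR N * phi + phi). replace (INR N * phi) with (u - phi) by (unfold u; ring).
      rewrite cos_plus, cos_minus. ring.
Qed.

Lemma sum_cosgap_ge x phi N : 0 <= x < 1 ->
  cosgap x phi - 2 * x ^ N * (x / (1 - x)) <= psum (fun m => x ^ m * (1 - cos (INR m * phi))) N.
Proof.
  intros Hx. pose proof (sum_cosgap_tail x phi N Hx) as E.
  pose proof (shifted_cos_le x phi (INR N * phi) Hx) as H.
  pose proof (sqdist_pos x phi Hx) as Hd.
  set (w := cos (INR N * phi + phi) - x * cos (INR N * phi)) in *.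
  assert (Hw : - (Rabs w / sqdist x phi) <= w / sqdist x phi).
  { unfold Rdiv. rewrite Ropp_mult_distr_l. apply Rmult_le_compat_r.
    - left. apply Rinv_0_lt_compat, Hd.
    - pose proof (Rle_abs (- w)). rewrite Rabs_Ropp in H0. lra. }
  assert (x ^ N * (x * (/ (1 - x) - w / sqdist x phi)) <= x ^ N * (x * (2 * / (1 - x)))).
  { apply Rmult_le_compat_l; [apply pow_le; lra|]. apply Rmult_le_compat_l; lra. }
  unfold Rdiv in *. lra.
Qed.

Lemma modulus_pos t N theta : 0 < t -> 0 < modulus t N theta.
Proof.
  intros Ht. unfold modulus. induction N as [|N IH]; [simpl; lra|].
  cbn [pprod]. apply Rmult_lt_0_compat; [exact IH|].
  apply factor_pos. pose proof (rho_bounds t (S N) Ht ltac:(lia)). lra.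
Qed.

Lemma modulus_ge t N theta : 0 < t ->
  exp (- (variance t N * theta ^ 2 / 2)) <= modulus t N theta.
Proof.
  intros Ht. unfold modulus, variance. induction N as [|N IH].
  - simpl. replace (- _) with 0 by field. rewrite exp_0. lra.
  - cbn [pprod psum].
    pose proof (rho_bounds t (S N) Ht ltac:(lia)) as Hr.
    pose proof (factor_ge (rho t (S N)) (INR (S N) * theta) ltac:(lra)) as H.
    eapply Rle_trans; [|apply Rmult_le_compat; [left; apply exp_pos|left; apply exp_pos|exact IH|exact H]].
    rewrite <- exp_plus. right. f_equal. field. lra.
Qed.

(** Summing over [m] first turns the [k]-th retained term into [cosgap] at [k t] and [k theta]; the
    subtracted quantity bounds the missing part [m > N]. *)
Lemma modulus_le t N theta : 0 < t ->
  modulus t N theta <= exp (- (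
    psum (fun k => / INR k * (cosgap (exp (- (INR k * t))) (INR k * theta)
      - 2 * exp (- (INR k * t)) ^ N * (exp (- (INR k * t)) / (1 - exp (- (INR k * t)))))) 3)).
Proof.
  intros Ht.
  apply Rle_trans with (exp (- psum (fun m =>
      psum (fun k => / INR k * (exp (- (INR k * t)) ^ m * (1 - cos (INR m * (INR k * theta))))) 3) N)).
  - unfold modulus. induction N as [|N IH]; [simpl; rewrite Ropp_0, exp_0; lra|].
    cbn [pprod]. change (psum ?f (S N)) with (psum f N + f (S N)).
    rewrite Ropp_plus_distr, exp_plus.
    pose proof (rho_bounds t (S N) Ht ltac:(lia)) as Hr.
    apply Rmult_le_compat.
    + left. apply (modulus_pos t N theta Ht).
    + left. apply factor_pos. lra.
    + exact IH.
    + eapply Rle_trans; [apply factor_le; lra|]. right. f_equal.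
      cbn [psum].
      assert (E : forall k, exp (- (INR k * t)) ^ S N = rho t (S N) ^ k).
      { intros k. rewrite rho_pow, exp_pow. f_equal. ring. }
      rewrite !E. set (a := INR (S N) * theta).
      replace (INR (S N) * (INR 1 * theta)) with a by (unfold a; simpl (INR 1); ring).
      replace (INR (S N) * (INR 2 * theta)) with (2 * a) by (unfold a; simpl (INR 2); ring).
      replace (INR (S N) * (INR 3 * theta)) with (3 * a) by (unfold a; simpl (INR 3); ring).
      simpl (INR 1); simpl (INR 2); simpl (INR 3). field.
  - apply exp_le_compat, Ropp_le_contravar. rewrite psum_swap. apply psum_le. intros k Hk.
    pose proof (INR_ge1 k (proj1 Hk)).
    rewrite psum_scal. apply Rmult_le_compat_l; [left; apply Rinv_0_lt_compat; lra|].
    apply sum_cosgap_ge.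
    pose proof (exp_neg_lt1 (INR k * t) ltac:(nra)). lra.
Qed.

Lemma one_minus_rcos_pos r a : 0 <= r < 1 -> 0 < 1 - r * cos a.
Proof. intros Hr. pose proof (COS_bound a). nra. Qed.

(* The derivative in [a] of the difference is [- cosgap r a]. *)
Lemma arg_factor_bound_pos r a : 0 <= r < 1 -> 0 <= a ->
  - (r * (1 + r) / (1 - r) ^ 3 * a ^ 3 / 6)
    <= atan (r * sin a / (1 - r * cos a)) - r / (1 - r) * a <= 0.
Proof.
  intros Hr Ha.
  assert (D : forall z, is_derive (fun a => atan (r * sin a / (1 - r * cos a)) - r / (1 - r) * a) z
     (- cosgap r z)).
  { intros z. pose proof (one_minus_rcos_pos r z Hr) as Hc.
    pose proof (cosgap_den_pos r z Hr) as Hd.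
    auto_derive; [lra|].
    pose proof (sin2_cos2 z) as E. unfold Rsqr in E.
    assert (E' : sin z ^ 2 = 1 - cos z ^ 2) by lra.
    assert (Hq : 0 < (1 - r * cos z) ^ 2 + (r * sin z) ^ 2).
    { pose proof (pow2_ge_0 (r * sin z)). assert (0 < (1 - r * cos z) ^ 2) by (apply pow_lt; lra). lra. }
    assert (E3 : (1 - r * cos z) ^ 2 + (r * sin z) ^ 2 = (1 - r) ^ 2 + 2 * r * (1 - cos z)).
    { rewrite Rpow_mult_distr, E'. ring. }
    unfold cosgap, Rsqr.
    match goal with |- ?L = ?Rr => replace L with
      ((r * cos z * (1 - r * cos z) - r ^ 2 * sin z ^ 2) / ((1 - r * cos z) ^ 2 + (r * sin z) ^ 2)
        - r / (1 - r)) end.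
    - rewrite E3, E'. field. lra.
    - field. repeat split; nra. }
  assert (A0 : atan (r * sin 0 / (1 - r * cos 0)) = 0).
  { rewrite sin_0. unfold Rdiv. rewrite Rmult_0_r, Rmult_0_l. apply atan_0. }
  split.
  - pose proof (derive_nonneg_le (fun a => atan (r * sin a / (1 - r * cos a)) - r / (1 - r) * a
      + r * (1 + r) / (1 - r) ^ 3 * a ^ 3 / 6)
      (fun z => - cosgap r z + r * (1 + r) / (1 - r) ^ 3 * z ^ 2 / 2) 0 a Ha) as H.
    cbv beta in H. rewrite A0 in H.
    match type of H with _ -> _ -> ?X => enough (HX : X) by lra end. apply H; clear H.
    + intros z Hz. apply (is_derive_plus (fun a => atan (r * sin a / (1 - r * cos a)) - r / (1 - r) * a)).
      * apply D.
      * auto_derive; [trivial|field; lra].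
    + intros z Hz. pose proof (cosgap_den_pos r z Hr) as Hd.
      (* Only [(1 - r) ^ 2] is kept in the denominator; integrating the resulting quadratic gives
         the cubic error. *)
      assert (cosgap r z <= r * (1 + r) / (1 - r) ^ 3 * z ^ 2 / 2); [|lra].
      unfold cosgap. pose proof (one_minus_cos_le z) as H1. pose proof (COS_bound z) as Hb.
      apply Rle_trans with (r * (1 + r) * (1 - cos z) / ((1 - r) * ((1 - r) ^ 2))).
      * apply Rmult_le_compat_l; [repeat apply Rmult_le_pos; lra|].
        assert (0 < (1 - r) ^ 2) by (apply pow_lt; lra).
        apply Rinv_le_contravar; [apply Rmult_lt_0_compat; lra|].
        apply Rmult_le_compat_l; [lra|]. nra.
      * replace (r * (1 + r) / (1 - r) ^ 3 * z ^ 2 / 2) with (r * (1 + r) * (z ^ 2 / 2) / ((1 - r) * (1 - r) ^ 2))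
          by (field; lra).
        apply Rmult_le_compat_r.
        -- left. apply Rinv_0_lt_compat. apply Rmult_lt_0_compat; [|apply pow_lt]; lra.
        -- apply Rmult_le_compat_l; [nra|lra].
  - pose proof (derive_nonneg_le (fun a => - (atan (r * sin a / (1 - r * cos a)) - r / (1 - r) * a))
      (fun z => cosgap r z) 0 a Ha) as H.
    cbv beta in H. rewrite A0 in H.
    match type of H with _ -> _ -> ?X => enough (HX : X) by lra end. apply H; clear H.
    + intros z Hz.
      pose proof (is_derive_opp (fun a => atan (r * sin a / (1 - r * cos a)) - r / (1 - r) * a) z _ (D z)) as H.
      unfold opp in H; simpl in H. rewrite Ropp_involutive in H. exact H.
    + intros z _. apply cosgap_nonneg, Hr.
Qed.

Lemma arg_factor_bound r a : 0 <= r < 1 ->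
  Rabs (atan (r * sin a / (1 - r * cos a)) - r / (1 - r) * a)
  <= r * (1 + r) / (1 - r) ^ 3 * Rabs a ^ 3 / 6.
Proof.
  intros Hr. destruct (Rle_dec 0 a) as [Ha|Ha].
  - rewrite (Rabs_pos_eq a Ha).
    pose proof (arg_factor_bound_pos r a Hr Ha). apply Rabs_le. lra.
  - rewrite (Rabs_left a) by lra.
    pose proof (arg_factor_bound_pos r (- a) Hr ltac:(lra)) as H.
    rewrite sin_neg, cos_neg in H.
    replace (r * - sin a / (1 - r * cos a)) with (- (r * sin a / (1 - r * cos a))) in H
      by (unfold Rdiv; ring).
    rewrite atan_opp in H. apply Rabs_le. lra.
Qed.

Lemma phase_bound t N theta : 0 < t ->
  Rabs (phase t N theta - mean t N * theta) <= cumulant3 t N * Rabs theta ^ 3 / 6.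
Proof.
  intros Ht.
  replace (phase t N theta - mean t N * theta) with
    (psum (fun m => atan (rho t m * sin (INR m * theta) / (1 - rho t m * cos (INR m * theta)))
       - rho t m / (1 - rho t m) * (INR m * theta)) N).
  - eapply Rle_trans; [apply Rabs_psum|].
    apply Rle_trans with (psum (fun m => Rabs theta ^ 3 / 6 *
      (INR m ^ 3 * (rho t m * (1 + rho t m) / (1 - rho t m) ^ 3))) N).
    + apply psum_le. intros m Hm.
      pose proof (rho_bounds t m Ht (proj1 Hm)) as Hr.
      eapply Rle_trans; [apply arg_factor_bound; lra|].
      rewrite Rabs_mult, (Rabs_pos_eq (INR m)) by apply pos_INR.
      right. field. lra.
    + rewrite psum_scal. right. unfold cumulant3. field.
  - unfold phase, mean. induction N as [|N IH]; cbn [psum]; [ring|rewrite IH; ring].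
Qed.

(** [cosgap] is [coth (y / 2)], at least [2 / y], times a quotient increasing in [1 - cos phi],
    where [(1 - x) ^ 2 = x (2 sinh (y / 2)) ^ 2]. The range of [y] is three times that of [t]: the
    bound is used at [k t] with [k <= 3]. *)
Lemma cosgap_ge y phi v : 0 < y <= 864 / 10000 -> 0 <= v <= 1 - cos phi ->
  2 / y * (v / (10038 / 10000 * y ^ 2 + 2 * v)) <= cosgap (exp (- y)) phi.
Proof.
  intros Hy Hv. pose proof (exp_neg_lt1 y (proj1 Hy)) as Hx.
  pose proof (cosgap_den_pos (exp (- y)) phi ltac:(lra)) as Hd.
  pose proof (sinh_le_cosh y ltac:(lra)) as Hs.
  pose proof (twosinh_le y ltac:(lra)) as Ht.
  pose proof (le_2sinh y ltac:(lra)) as Hl.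
  assert (Ex : exp (- y) = exp (- (y / 2)) * exp (- (y / 2)))
    by (rewrite <- exp_plus; f_equal; field).
  assert (E1 : exp (y / 2) * exp (- (y / 2)) = 1)
    by (rewrite <- exp_plus, <- exp_0; f_equal; ring).
  pose proof (exp_pos (- (y / 2))) as Hz.
  set (x := exp (- y)) in *. set (z := exp (- (y / 2))) in *. set (w := exp (y / 2)) in *.
  assert (A : 2 / y <= (1 + x) / (1 - x)).
  { apply div_le_div; [lra|lra|]. rewrite Ex.
    replace (1 - z * z) with (z * (w - z)) by (rewrite <- E1; ring).
    replace (1 + z * z) with (z * (w + z)) by (rewrite <- E1; ring). nra. }
  assert (B : (1 - x) ^ 2 <= x * (10038 / 10000 * y ^ 2)).
  { rewrite Ex. replace (1 - z * z) with (z * (w - z)) by (rewrite <- E1; ring).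
    replace ((z * (w - z)) ^ 2) with (z * z * (w - z) ^ 2) by ring.
    apply Rmult_le_compat_l; [nra|].
    assert (Hw : w - z <= 100188 / 100000 * y).
    { eapply Rle_trans; [exact Ht|].
      apply (Rmult_le_reg_r (1 - (y / 2) ^ 2)); [nra|].
      unfold Rdiv at 1. rewrite Rmult_assoc, Rinv_l by nra.
      assert (1 <= 100188 / 100000 * (1 - (y / 2) ^ 2)) by nra. nra. }
    apply Rle_trans with ((100188 / 100000 * y) ^ 2).
    - apply pow_incr. lra.
    - nra. }
  assert (HV : 0 <= 1 - cos phi) by lra. set (V := 1 - cos phi) in *.
  replace (cosgap x phi) with ((1 + x) / (1 - x) * (x * V / ((1 - x) ^ 2 + 2 * x * V))).
  2:{ unfold cosgap. fold V. field. lra. }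
  assert (P : 0 < 10038 / 10000 * y ^ 2) by (assert (0 < y ^ 2) by (apply pow_lt; lra); lra).
  apply Rmult_le_compat; [apply Rdiv_le_0_compat; lra|apply Rdiv_le_0_compat; lra|exact A|].
  apply div_le_div; [lra|exact Hd|].
  set (Y := 10038 / 10000 * y ^ 2) in *.
  assert (v * (1 - x) ^ 2 <= v * (x * Y)) by (apply Rmult_le_compat_l; lra).
  assert (v * (x * Y) <= V * (x * Y)) by (apply Rmult_le_compat_r; [apply Rmult_le_pos|]; lra).
  lra.
Qed.

Lemma cosgap_ge_near y phi : 0 < y <= 864 / 10000 -> Rabs phi <= 3 / 2 * y ->
  9948 / 10000 / y * (phi ^ 2 / (y ^ 2 + phi ^ 2)) <= cosgap (exp (- y)) phi.
Proof.
  intros Hy Hphi.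
  assert (H2 : phi ^ 2 <= 9 / 4 * y ^ 2).
  { rewrite <- (pow2_abs phi). pose proof (Rabs_pos phi). nra. }
  pose proof (one_minus_cos_ge phi) as Hc.
  pose proof (pow2_ge_0 phi) as H0.
  assert (Hyy : 0 < y ^ 2) by (apply pow_lt; lra).
  assert (y ^ 2 <= 74650 / 10000000) by nra.
  (* [1 - phi ^ 2 / 12 >= 0.9986] on this range, and [0.9986 / 1.0038 >= 0.9948]. *)
  set (v := 9986 / 10000 * (phi ^ 2 / 2)).
  assert (Hv : 0 <= v <= 1 - cos phi).
  { unfold v. split; [lra|]. eapply Rle_trans; [|exact Hc].
    rewrite Rmult_comm. apply Rmult_le_compat_l; [lra|]. lra. }
  eapply Rle_trans; [|apply (cosgap_ge y phi v Hy Hv)].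
  replace (9948 / 10000 / y * (phi ^ 2 / (y ^ 2 + phi ^ 2)))
    with (2 / y * (9948 / 20000 * phi ^ 2 / (y ^ 2 + phi ^ 2))) by (field; lra).
  apply Rmult_le_compat_l; [apply Rdiv_le_0_compat; lra|].
  apply div_le_div; [lra|lra|]. unfold v. nra.
Qed.

Lemma tail_le t N : 0 < t -> exp (- (INR N * t)) / t <= / 2000 ->
  psum (fun k => / INR k * (2 * exp (- (INR k * t)) ^ N *
     (exp (- (INR k * t)) / (1 - exp (- (INR k * t)))))) 3 <= 19 / 10000.
Proof.
  intros Ht HN.
  apply Rle_trans with (psum (fun k => / INR k * / 1000) 3).
  - apply psum_le. intros k Hk. pose proof (INR_ge1 k (proj1 Hk)) as Hk'.
    apply Rmult_le_compat_l; [left; apply Rinv_0_lt_compat; lra|].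
    assert (Hkt : t <= INR k * t) by nra.
    pose proof (geo0_le (INR k * t) ltac:(lra)) as H0.
    assert (/ (INR k * t) <= / t) by (apply Rinv_le_contravar; lra).
    assert (E : exp (- (INR k * t)) ^ N <= exp (- (INR N * t))).
    { rewrite exp_pow. apply exp_le_compat. pose proof (pos_INR N). nra. }
    assert (0 <= exp (- (INR k * t)) ^ N) by (apply pow_le; left; apply exp_pos).
    assert (0 <= exp (- (INR k * t)) / (1 - exp (- (INR k * t)))).
    { pose proof (exp_neg_lt1 (INR k * t) ltac:(lra)). apply Rdiv_le_0_compat; lra. }
    apply Rle_trans with (2 * exp (- (INR N * t)) * / t).
    + apply Rmult_le_compat; lra.
    + unfold Rdiv in HN. lra.
  - simpl. lra.
Qed.

Lemma exp_tail_le : exp (19 / 10000) <= 1002 / 1000.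
Proof.
  replace (19 / 10000) with (- - (19 / 10000)) by ring. rewrite exp_Ropp.
  apply Rle_trans with (/ (1 - 19 / 10000)); [|lra].
  apply Rinv_le_contravar; [lra|]. pose proof (exp_ineq1_le (- (19 / 10000))). lra.
Qed.

Lemma modulus_le_gap t N theta c : 0 < t -> exp (- (INR N * t)) / t <= / 2000 ->
  c <= psum (fun k => / INR k * cosgap (exp (- (INR k * t))) (INR k * theta)) 3 ->
  modulus t N theta <= 1002 / 1000 * exp (- c).
Proof.
  intros Ht HN Hc. eapply Rle_trans; [apply modulus_le, Ht|].
  apply Rle_trans with (exp (19 / 10000) * exp (- c)).
  - rewrite <- exp_plus. apply exp_le_compat.
    pose proof (tail_le t N Ht HN) as HT. cbn [psum] in *. lra.
  - apply Rmult_le_compat_r; [left; apply exp_pos|apply exp_tail_le].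
Qed.

(** The quotient is unchanged when [t] and [theta] are both multiplied by [k], so the [k]-th term is
    bounded by the first bound over [k ^ 2], and [(1 + 1/4 + 1/9) 0.9948 >= 1.35]. *)
Lemma modulus_le_near t N theta : 0 < t <= 288 / 10000 -> exp (- (INR N * t)) / t <= / 2000 ->
  Rabs theta <= 3 / 2 * t ->
  modulus t N theta <= 1002 / 1000 * exp (- (135 / 100 / t * (theta ^ 2 / (t ^ 2 + theta ^ 2)))).
Proof.
  intros Ht HN Hth. apply modulus_le_gap; [lra|exact HN|].
  assert (Ht2 : 0 < t ^ 2) by (apply pow_lt; lra).
  pose proof (pow2_ge_0 theta) as H0.
  set (f := 9948 / 10000 / t * (theta ^ 2 / (t ^ 2 + theta ^ 2))).
  assert (Hf : 0 <= f).
  { unfold f. apply Rmult_le_pos; apply Rdiv_le_0_compat; lra. }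
  apply Rle_trans with (psum (fun k => / INR k ^ 2 * f) 3).
  - replace (135 / 100 / t * (theta ^ 2 / (t ^ 2 + theta ^ 2))) with (13500 / 9948 * f)
      by (unfold f; field; lra).
    simpl. lra.
  - apply psum_le. intros k Hk. pose proof (INR_ge1 k (proj1 Hk)) as Hk'.
    assert (INR k <= 3) by (pose proof (le_INR k 3 ltac:(lia)) as L; simpl in L; lra).
    replace (/ INR k ^ 2 * f) with (/ INR k * (9948 / 10000 / (INR k * t) *
       ((INR k * theta) ^ 2 / ((INR k * t) ^ 2 + (INR k * theta) ^ 2)))).
    + apply Rmult_le_compat_l; [left; apply Rinv_0_lt_compat; lra|].
      apply cosgap_ge_near; [nra|].
      rewrite Rabs_mult, (Rabs_pos_eq (INR k)) by lra. nra.
    + unfold f. field. assert (0 < INR k ^ 2) by (apply pow_lt; lra). repeat split; nra.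
Qed.

Lemma modulus_le_major t N theta : 0 < t <= 288 / 10000 -> exp (- (INR N * t)) / t <= / 2000 ->
  Rabs theta <= t / 2 ->
  modulus t N theta <= 1002 / 1000 * exp (- (216 / 100 / t ^ 3 * theta ^ 2 / 2)).
Proof.
  intros Ht HN Hth. eapply Rle_trans; [apply modulus_le_near; lra|].
  apply Rmult_le_compat_l; [lra|]. apply exp_le_compat, Ropp_le_contravar.
  assert (Ht2 : 0 < t ^ 2) by (apply pow_lt; lra).
  assert (theta ^ 2 <= t ^ 2 / 4).
  { rewrite <- (pow2_abs theta). pose proof (Rabs_pos theta). nra. }
  pose proof (pow2_ge_0 theta) as H0.
  replace (216 / 100 / t ^ 3 * theta ^ 2 / 2)
    with (135 / 100 / t * (theta ^ 2 / (5 / 4 * t ^ 2))) by (field; lra).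
  apply Rmult_le_compat_l; [apply Rdiv_le_0_compat; lra|].
  apply Rmult_le_compat_l; [lra|]. apply Rinv_le_contravar; lra.
Qed.

Lemma modulus_le_middle t N theta : 0 < t <= 288 / 10000 -> exp (- (INR N * t)) / t <= / 2000 ->
  t / 2 <= Rabs theta <= 3 / 2 * t ->
  modulus t N theta <= 1002 / 1000 * exp (- (27 / 100 / t)).
Proof.
  intros Ht HN Hth. eapply Rle_trans; [apply modulus_le_near; lra|].
  apply Rmult_le_compat_l; [lra|]. apply exp_le_compat, Ropp_le_contravar.
  assert (Ht2 : 0 < t ^ 2) by (apply pow_lt; lra).
  assert (t ^ 2 / 4 <= theta ^ 2).
  { rewrite <- (pow2_abs theta). nra. }
  replace (27 / 100 / t) with (135 / 100 / t * (1 / 5)) by (field; lra).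
  apply Rmult_le_compat_l; [apply Rdiv_le_0_compat; lra|].
  apply div_le_div; lra.
Qed.

(** Only [k = 1] is kept, since [2 theta] and [3 theta] may reach [2 pi]. On this zone
    [1 - cos theta] is smallest at [3 t / 2], where it is at least [1.124 t ^ 2]. *)
Lemma modulus_le_outer t N theta : 0 < t <= 288 / 10000 -> exp (- (INR N * t)) / t <= / 2000 ->
  3 / 2 * t <= Rabs theta <= PI ->
  modulus t N theta <= 1002 / 1000 * exp (- (69 / 100 / t)).
Proof.
  intros Ht HN Hth. apply modulus_le_gap; [lra|exact HN|].
  assert (Ht2 : 0 < t ^ 2) by (apply pow_lt; lra).
  assert (t ^ 2 <= 8295 / 10000000) by nra.
  apply Rle_trans with (cosgap (exp (- t)) theta).
  - set (v := 1124 / 1000 * t ^ 2).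
    assert (Hv : 0 <= v <= 1 - cos theta).
    { unfold v. split; [lra|].
      apply Rle_trans with (1 - cos (3 / 2 * t)).
      - eapply Rle_trans; [|apply one_minus_cos_ge]. nra.
      - assert (cos (Rabs theta) <= cos (3 / 2 * t)) by (apply cos_decr_1; lra).
        unfold Rabs in *. destruct (Rcase_abs theta); [rewrite cos_neg in *|]; lra. }
    eapply Rle_trans; [|apply (cosgap_ge t theta v); [lra|exact Hv]].
    replace (69 / 100 / t) with (2 / t * (345 / 1000)) by (field; lra).
    apply Rmult_le_compat_l; [apply Rdiv_le_0_compat; lra|].
    apply div_le_div; unfold v; lra.
  - cbn [psum]. simpl (INR 1). rewrite Rinv_1, !Rmult_1_l, Rplus_0_l.
    assert (G : forall k, (1 <= k)%nat -> 0 <= / INR k * cosgap (exp (- (INR k * t))) (INR k * theta)).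
    { intros k Hk. pose proof (INR_ge1 k Hk).
      apply Rmult_le_pos; [left; apply Rinv_0_lt_compat; lra|].
      apply cosgap_nonneg. pose proof (exp_neg_lt1 (INR k * t) ltac:(nra)). lra. }
    pose proof (G 2%nat ltac:(lia)). pose proof (G 3%nat ltac:(lia)). lra.
Qed.

(** * Fourier coefficients *)

Lemma ex_derive_modulus t N theta : 0 < t -> ex_derive (modulus t N) theta.
Proof.
  intros Ht. induction N as [|N IH].
  - apply (ex_derive_ext (fun _ => 1)); [reflexivity|apply ex_derive_const].
  - pose proof (rho_bounds t (S N) Ht ltac:(lia)) as Hr.
    pose proof (sqdist_pos (rho t (S N)) (INR (S N) * theta) ltac:(lra)) as Hd.
    pose proof (sqrt_lt_R0 _ Hd) as Hs.
    apply (ex_derive_ext (fun theta => modulus t N theta *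
      ((1 - rho t (S N)) / sqrt (sqdist (rho t (S N)) (INR (S N) * theta))))); [reflexivity|].
    set (n := INR (S N)) in *. unfold sqdist in *.
    apply @ex_derive_mult; [exact IH|].
    auto_derive. repeat split; try lra. unfold Rminus in *. simpl pow in *. lra.
Qed.

Lemma ex_derive_phase t N theta : 0 < t -> ex_derive (phase t N) theta.
Proof.
  intros Ht. induction N as [|N IH].
  - apply (ex_derive_ext (fun _ => 0)); [reflexivity|apply ex_derive_const].
  - pose proof (rho_bounds t (S N) Ht ltac:(lia)) as Hr.
    pose proof (one_minus_rcos_pos (rho t (S N)) (INR (S N) * theta) ltac:(lra)) as Hd.
    apply (ex_derive_ext (fun theta => phase t N theta + atan (rho t (S N) * sin (INR (S N) * theta)
      / (1 - rho t (S N) * cos (INR (S N) * theta))))); [reflexivity|].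
    set (n := INR (S N)) in *.
    apply @ex_derive_plus; [exact IH|]. auto_derive. lra.
Qed.

Lemma ex_RInt_of_derive (f : R -> R) a b : (forall x, ex_derive f x) -> ex_RInt f a b.
Proof.
  intros H. apply (ex_RInt_continuous f). intros x _. apply (ex_derive_continuous f), H.
Qed.

Lemma modulus_le1 t N theta : 0 < t -> modulus t N theta <= 1.
Proof.
  intros Ht. induction N as [|N IH]; [unfold modulus; simpl; lra|].
  pose proof (rho_bounds t (S N) Ht ltac:(lia)) as Hr.
  change (modulus t (S N) theta) with (modulus t N theta *
      ((1 - rho t (S N)) / sqrt (sqdist (rho t (S N)) (INR (S N) * theta)))).
  pose proof (modulus_pos t N theta Ht).
  pose proof (sqdist_pos (rho t (S N)) (INR (S N) * theta) ltac:(lra)) as Hd.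
  pose proof (sqdist_ge (rho t (S N)) (INR (S N) * theta) ltac:(lra)) as Hg.
  pose proof (sqrt_lt_R0 _ Hd) as Hs.
  assert (1 - rho t (S N) <= sqrt (sqdist (rho t (S N)) (INR (S N) * theta))).
  { rewrite <- (sqrt_pow2 (1 - rho t (S N))) by lra. apply sqrt_le_1_alt, Hg. }
  assert ((1 - rho t (S N)) / sqrt (sqdist (rho t (S N)) (INR (S N) * theta)) <= 1).
  { apply (Rmult_le_reg_r (sqrt (sqdist (rho t (S N)) (INR (S N) * theta)))); [lra|].
    unfold Rdiv. rewrite Rmult_assoc, Rinv_l by lra. lra. }
  pose proof (factor_pos (rho t (S N)) (INR (S N) * theta) ltac:(lra)). nra.
Qed.

(** The imaginary part of the complex integrand is odd in [theta], so the cosine alone gives the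
    whole Fourier integral. *)
Definition fourier (t : R) (N : nat) (j : Z) : R :=
  RInt (fun theta => modulus t N theta * cos (phase t N theta - IZR j * theta)) (- PI) PI.

Lemma ex_RInt_fourier t N j : 0 < t ->
  ex_RInt (fun theta => modulus t N theta * cos (phase t N theta - IZR j * theta)) (- PI) PI.
Proof.
  intros Ht. apply ex_RInt_of_derive. intros x.
  pose proof (ex_derive_modulus t N x Ht). pose proof (ex_derive_phase t N x Ht).
  auto_derive. tauto.
Qed.

(* [1 - r exp (i a) = s exp (- i b)], where [s] is the modulus and [b] the arctangent. *)
Lemma polar_factor r a psi : 0 <= r < 1 ->
  let b := atan (r * sin a / (1 - r * cos a)) in
  cos (psi + b) - r * cos (psi + b + a) = sqrt (sqdist r a) * cos psi.
Proof.
  intros Hr b.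
  pose proof (one_minus_rcos_pos r a Hr) as Hc.
  pose proof (sqdist_pos r a Hr) as Hd. pose proof (sqrt_lt_R0 _ Hd) as Hs.
  set (s := sqrt (sqdist r a)) in *.
  assert (Es : sqrt (1 + (r * sin a / (1 - r * cos a))²) = s / (1 - r * cos a)).
  { assert (E : 1 + (r * sin a / (1 - r * cos a))² = sqdist r a / (1 - r * cos a)²).
    { unfold sqdist, Rsqr. pose proof (sin2_cos2 a) as E. unfold Rsqr in E.
      replace (1 - 2 * r * cos a + r ^ 2)
        with (1 - 2 * r * cos a + r ^ 2 * (sin a * sin a + cos a * cos a)) by (rewrite E; ring).
      field. lra. }
    rewrite E, sqrt_div_alt by (apply Rlt_0_sqr; lra). rewrite sqrt_Rsqr by lra. reflexivity. }
  assert (Cb : cos b = (1 - r * cos a) / s).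
  { unfold b. rewrite cos_atan, Es. field. lra. }
  assert (Sb : sin b = r * sin a / s).
  { unfold b. rewrite sin_atan, Es. field. lra. }
  rewrite (cos_plus (psi + b) a), (cos_plus psi b), (sin_plus psi b), Cb, Sb.
  assert (Ess : s * s = 1 - 2 * r * cos a + r ^ 2 * (sin a * sin a + cos a * cos a)).
  { unfold s. rewrite sqrt_sqrt by lra. unfold sqdist.
    pose proof (sin2_cos2 a) as E. unfold Rsqr in E. rewrite E. ring. }
  apply (Rmult_eq_reg_r s); [|lra].
  replace (s * cos psi * s) with (s * s * cos psi) by ring. rewrite Ess. field. lra.
Qed.

(** Multiplying the generating function by [1 - z^(N+1)] removes its last factor. [polar_factor] is
    the real part of this at each [theta]; [rho] comes from the radius and [1 - rho] from the
    normalisation. *)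
Lemma fourier_rec t N j : 0 < t ->
  fourier t (S N) j - rho t (S N) * fourier t (S N) (j - Z.of_nat (S N))
  = (1 - rho t (S N)) * fourier t N j.
Proof.
  intros Ht. unfold fourier.
  pose proof (rho_bounds t (S N) Ht ltac:(lia)) as Hr.
  assert (Ej : IZR (j - Z.of_nat (S N)) = IZR j - INR (S N))
    by (rewrite minus_IZR, <- INR_IZR_INZ; reflexivity).
  rewrite Ej.
  rewrite <- (RInt_scal (V := R_CompleteNormedModule) _ _ _ (rho t (S N)))
    by (rewrite <- Ej; apply ex_RInt_fourier, Ht).
  rewrite <- (RInt_scal (V := R_CompleteNormedModule) _ _ _ (1 - rho t (S N)))
    by (apply ex_RInt_fourier, Ht).
  rewrite <- (RInt_minus (V := R_CompleteNormedModule)); [|apply ex_RInt_fourier, Ht|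
    rewrite <- Ej; apply (ex_RInt_scal (V := R_NormedModule)), ex_RInt_fourier, Ht].
  apply RInt_ext. intros theta _. unfold minus, plus, opp, scal, mult. cbn -[INR IZR modulus phase].
  unfold mult. cbn -[INR IZR modulus phase].
  change (modulus t (S N) theta) with (modulus t N theta *
      ((1 - rho t (S N)) / sqrt (sqdist (rho t (S N)) (INR (S N) * theta)))).
  change (phase t (S N) theta) with (phase t N theta + atan (rho t (S N) * sin (INR (S N) * theta)
      / (1 - rho t (S N) * cos (INR (S N) * theta)))).
  clear Ej. set (n := INR (S N)) in *. set (r := rho t (S N)) in *.
  pose proof (polar_factor r (n * theta) (phase t N theta - IZR j * theta) ltac:(lra)) as P.
  cbv zeta in P. set (b := atan (r * sin (n * theta) / (1 - r * cos (n * theta)))) in *.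
  replace (phase t N theta + b - IZR j * theta) with (phase t N theta - IZR j * theta + b) by ring.
  replace (phase t N theta + b - (IZR j - n) * theta)
    with (phase t N theta - IZR j * theta + b + n * theta) by ring.
  pose proof (sqrt_lt_R0 _ (sqdist_pos r (n * theta) ltac:(lra))) as Hs.
  set (s := sqrt (sqdist r (n * theta))) in *.
  set (psi := phase t N theta - IZR j * theta) in *.
  replace (modulus t N theta * ((1 - r) / s) * cos (psi + b) +
    - (r * (modulus t N theta * ((1 - r) / s) * cos (psi + b + n * theta))))
    with (modulus t N theta * ((1 - r) / s) * (cos (psi + b) - r * cos (psi + b + n * theta)))
    by ring.
  rewrite P. field. lra.
Qed.

Lemma fourier_bound t N j : 0 < t -> Rabs (fourier t N j) <= 2 * PI.
Proof.
  intros Ht. unfold fourier. pose proof PI_RGT_0.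
  replace (2 * PI) with ((PI - - PI) * 1) by ring.
  apply abs_RInt_le_const; [lra|apply ex_RInt_fourier, Ht|].
  intros x _. rewrite Rabs_mult.
  pose proof (modulus_pos t N x Ht). pose proof (modulus_le1 t N x Ht).
  rewrite Rabs_pos_eq by lra.
  assert (Rabs (cos (phase t N x - IZR j * x)) <= 1) by (apply Rabs_le, COS_bound).
  pose proof (Rabs_pos (cos (phase t N x - IZR j * x))). nra.
Qed.

Lemma fourier_0 t j : fourier t 0 j = if Z.eq_dec j 0 then 2 * PI else 0.
Proof.
  unfold fourier.
  rewrite (RInt_ext _ (fun theta => cos (IZR j * theta))).
  2:{ intros x _. unfold modulus, phase. simpl. rewrite Rminus_0_l, cos_neg. ring. }
  destruct (Z.eq_dec j 0) as [->|Hj].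
  - rewrite (RInt_ext _ (fun _ => 1)).
    + rewrite RInt_const. unfold scal; simpl; unfold mult; simpl. ring.
    + intros x _. rewrite Rmult_0_l. apply cos_0.
  - assert (Hj' : IZR j <> 0) by (apply not_0_IZR, Hj).
    apply is_RInt_unique.
    replace 0 with (minus (sin (IZR j * PI) / IZR j) (sin (IZR j * - PI) / IZR j)).
    + apply (is_RInt_derive (fun x => sin (IZR j * x) / IZR j)).
      * intros x _. auto_derive; [trivial|field; exact Hj'].
      * intros x _. apply (ex_derive_continuous (fun x => cos (IZR j * x))). auto_derive. trivial.
    + rewrite Ropp_mult_distr_r_reverse, sin_neg, (sin_eq_0_1 (IZR j * PI)) by (exists j; ring).
      unfold minus, plus, opp; simpl. field. exact Hj'.
Qed.

Definition euler_product (t : R) (N : nat) : R := pprod (fun m => / (1 - rho t m)) N.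

Lemma euler_product_pos t N : 0 < t -> 0 < euler_product t N.
Proof.
  intros Ht. unfold euler_product. induction N as [|N IH]; [simpl; lra|].
  cbn [pprod]. apply Rmult_lt_0_compat; [exact IH|].
  pose proof (rho_bounds t (S N) Ht ltac:(lia)). apply Rinv_0_lt_compat. lra.
Qed.

(** Undoes the normalisation at [theta = 0] and the radius [exp (- t)], so that [t] drops out of the
    recurrence. *)
Definition coefficient (t : R) (N : nat) (j : Z) : R :=
  euler_product t N * fourier t N j * exp (t * IZR j).

Lemma coefficient_rec t N j : 0 < t ->
  coefficient t (S N) j = coefficient t N j + coefficient t (S N) (j - Z.of_nat (S N)).
Proof.
  intros Ht. pose proof (fourier_rec t N j Ht) as H. unfold coefficient.
  change (euler_product t (S N)) with (euler_product t N * / (1 - rho t (S N))).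
  pose proof (rho_bounds t (S N) Ht ltac:(lia)) as Hr.
  replace (exp (t * IZR (j - Z.of_nat (S N)))) with (rho t (S N) * exp (t * IZR j)).
  2:{ unfold rho. rewrite <- exp_plus, minus_IZR, <- INR_IZR_INZ. f_equal. ring. }
  set (r := rho t (S N)) in *.
  replace (fourier t N j) with ((fourier t (S N) j - r * fourier t (S N) (j - Z.of_nat (S N))) / (1 - r)).
  - field. lra.
  - rewrite H. field. lra.
Qed.

(* For [j < 0] the recurrence can be iterated for ever, while [exp (t j)] tends to [0]. *)
Lemma coefficient_neg t N j : 0 < t -> (j < 0)%Z -> coefficient t N j = 0.
Proof.
  intros Ht. revert j. induction N as [|N IH]; intros j Hj.
  - unfold coefficient. rewrite fourier_0. destruct (Z.eq_dec j 0); [lia|]. ring.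
  - assert (It : forall k : nat, coefficient t (S N) j
      = coefficient t (S N) (j - Z.of_nat k * Z.of_nat (S N))).
    { induction k as [|k IHk]; [f_equal; lia|].
      rewrite IHk, coefficient_rec, IH by (try lra; lia).
      rewrite Rplus_0_l. f_equal. lia. }
    set (C := euler_product t (S N) * (2 * PI)).
    assert (HC : 0 < C).
    { unfold C. apply Rmult_lt_0_compat; [apply euler_product_pos, Ht|]. pose proof PI_RGT_0. lra. }
    (* After [k] iterations the size is at most [C exp (- t k)], and [y exp (- y) <= 1]; a nonzero
       value would contradict this for large [k]. *)
    assert (B : forall k : nat, (1 <= k)%nat -> Rabs (coefficient t (S N) j) * (t * INR k) <= C).
    { intros k Hk. rewrite (It k). unfold coefficient.
      rewrite !Rabs_mult, (Rabs_pos_eq (exp _)) by (left; apply exp_pos).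
      rewrite (Rabs_pos_eq (euler_product _ _)) by (left; apply euler_product_pos, Ht).
      pose proof (fourier_bound t (S N) (j - Z.of_nat k * Z.of_nat (S N)) Ht) as Hf.
      pose proof (INR_ge1 k Hk) as Hk'.
      assert (He : exp (t * IZR (j - Z.of_nat k * Z.of_nat (S N))) * (t * INR k) <= 1).
      { apply Rle_trans with (exp (- (t * INR k)) * exp (t * INR k)).
        - apply Rmult_le_compat; [left; apply exp_pos|nra| |].
          + apply exp_le_compat. rewrite Ropp_mult_distr_r. apply Rmult_le_compat_l; [lra|].
            rewrite INR_IZR_INZ, <- opp_IZR. apply IZR_le. nia.
          + pose proof (exp_ineq1_le (t * INR k)). lra.
        - right. rewrite <- exp_plus, <- exp_0. f_equal. ring. }
      set (e := exp (t * IZR (j - Z.of_nat k * Z.of_nat (S N)))) in *.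
      replace (euler_product t (S N) * Rabs (fourier t (S N) (j - Z.of_nat k * Z.of_nat (S N))) * e * (t * INR k))
        with (euler_product t (S N) * (Rabs (fourier t (S N) (j - Z.of_nat k * Z.of_nat (S N))) * (e * (t * INR k))))
        by ring.
      unfold C. apply Rmult_le_compat_l; [left; apply euler_product_pos, Ht|].
      rewrite <- (Rmult_1_r (2 * PI)).
      apply Rmult_le_compat; [apply Rabs_pos| |exact Hf|exact He].
      apply Rmult_le_pos; [left; apply exp_pos|nra]. }
    destruct (Req_dec (coefficient t (S N) j) 0) as [|Hne]; [assumption|exfalso].
    pose proof (Rabs_pos_lt _ Hne) as Hp. set (X := Rabs (coefficient t (S N) j)) in *.
    destruct (nfloor_ex (C / (X * t))) as [k Hk].
    { apply Rdiv_le_0_compat; [lra|]. apply Rmult_lt_0_compat; lra. }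
    pose proof (B (S k) ltac:(lia)) as HB. rewrite S_INR in HB.
    assert (C / (X * t) * (X * t) < (INR k + 1) * (X * t)).
    { apply Rmult_lt_compat_r; [apply Rmult_lt_0_compat|]; lra. }
    unfold Rdiv in H. rewrite Rmult_assoc, Rinv_l in H by nra. lra.
Qed.

(** Both sides obey [parts_le_rec] with the same values at [N = 0]; [coefficient_neg] handles
    indices that leave the natural numbers. *)
Lemma coefficient_parts_le t N j : 0 < t ->
  coefficient t N (Z.of_nat j) = 2 * PI * INR (parts_le N j).
Proof.
  intros Ht. revert j. induction N as [|N IH].
  - intros j. unfold coefficient. rewrite fourier_0. unfold euler_product. simpl pprod.
    destruct j as [|j].
    + simpl. rewrite Rmult_0_r, exp_0. ring.
    + destruct (Z.eq_dec (Z.of_nat (S j)) 0); [lia|]. simpl. ring.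
  - intros j. induction j as [j IHj] using (well_founded_induction Wf_nat.lt_wf).
    rewrite coefficient_rec, IH by exact Ht.
    destruct (Nat.lt_ge_cases j (S N)) as [Hj|Hj].
    + rewrite coefficient_neg by (try lra; lia).
      rewrite parts_le_small by exact Hj. ring.
    + replace (Z.of_nat j - Z.of_nat (S N))%Z with (Z.of_nat (j - S N)) by lia.
      rewrite IHj by lia.
      pose proof (parts_le_step N (j - S N)) as E.
      replace (S N + (j - S N))%nat with j in E by lia.
      rewrite E, plus_INR. ring.
Qed.

(** * Gaussian integrals *)

Definition gauss (b x : R) : R := exp (- (b * x ^ 2 / 2)).

Lemma ex_RInt_gauss_mul b k c u v : ex_RInt (fun x => c * (x ^ k * gauss b x)) u v.
Proof. apply ex_RInt_of_derive. intros x. unfold gauss. auto_derive. trivial. Qed.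

Lemma ex_RInt_gauss b u v : ex_RInt (gauss b) u v.
Proof. apply ex_RInt_of_derive. intros x. unfold gauss. auto_derive. trivial. Qed.

Lemma gauss_pos b x : 0 < gauss b x.
Proof. apply exp_pos. Qed.

(** The boundary terms of [p * gauss b] have the favourable sign, so the constant of the full-line
    moment also bounds the moment on the truncated interval. In the uses [c] is
    [1 * 3 * ... * (2k - 1)]. *)
Lemma gauss_moment_by_parts b h c k (p : R -> R) : 0 < b -> 0 <= h ->
  (forall x, is_derive (fun x => p x * gauss b x) x ((c - b ^ k * x ^ (2 * k)) * gauss b x)) ->
  p (- h) <= 0 <= p h ->
  RInt (fun x => x ^ (2 * k) * gauss b x) (- h) h <= c / b ^ k * RInt (gauss b) (- h) h.
Proof.
  intros Hb Hh Hd Hp.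
  assert (Hbk : 0 < b ^ k) by (apply pow_lt, Hb).
  assert (I : is_RInt (fun x => (c - b ^ k * x ^ (2 * k)) * gauss b x) (- h) h
    (p h * gauss b h - p (- h) * gauss b (- h))).
  { apply (is_RInt_derive (fun x => p x * gauss b x)).
    - intros x _. apply Hd.
    - intros x _. apply (ex_derive_continuous (fun x => (c - b ^ k * x ^ (2 * k)) * gauss b x)).
      unfold gauss. auto_derive. trivial. }
  apply (is_RInt_unique (V := R_CompleteNormedModule)) in I.
  assert (X : ex_RInt (fun x => x ^ (2 * k) * gauss b x) (- h) h).
  { apply ex_RInt_of_derive. intros x. unfold gauss. auto_derive. trivial. }
  assert (I2 : is_RInt (fun x => (c - b ^ k * x ^ (2 * k)) * gauss b x) (- h) h
    (c * RInt (gauss b) (- h) h - b ^ k * RInt (fun x => x ^ (2 * k) * gauss b x) (- h) h)).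
  { apply (is_RInt_ext (fun x => minus (scal c (gauss b x)) (scal (b ^ k) (x ^ (2 * k) * gauss b x)))).
    - intros x _. unfold minus, plus, opp, scal, mult. cbn -[pow Nat.mul]. unfold mult.
      cbn -[pow Nat.mul]. ring.
    - apply (is_RInt_minus (V := R_NormedModule));
        apply (is_RInt_scal (V := R_NormedModule));
        apply (RInt_correct (V := R_CompleteNormedModule)); [apply ex_RInt_gauss|exact X]. }
  apply (is_RInt_unique (V := R_CompleteNormedModule)) in I2. rewrite I in I2.
  pose proof (gauss_pos b h). pose proof (gauss_pos b (- h)).
  assert (0 <= p h * gauss b h - p (- h) * gauss b (- h)) by nra.
  rewrite I2 in H1.
  apply (Rmult_le_reg_l (b ^ k)); [exact Hbk|].
  replace (b ^ k * (c / b ^ k * RInt (gauss b) (- h) h)) with (c * RInt (gauss b) (- h) h)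
    by (field; lra).
  lra.
Qed.

Lemma gauss_moment2 b h : 0 < b -> 0 <= h ->
  RInt (fun x => x ^ 2 * gauss b x) (- h) h <= / b * RInt (gauss b) (- h) h.
Proof.
  intros Hb Hh. pose proof (gauss_moment_by_parts b h 1 1 (fun x => x) Hb Hh) as H.
  replace (/ b) with (1 / b ^ 1) by (field; lra). apply H; [|lra].
  intros x. unfold gauss. auto_derive; [trivial|simpl; unfold Rdiv; field].
Qed.

Lemma gauss_moment4 b h : 0 < b -> 0 <= h ->
  RInt (fun x => x ^ 4 * gauss b x) (- h) h <= 3 / b ^ 2 * RInt (gauss b) (- h) h.
Proof.
  intros Hb Hh.
  apply (gauss_moment_by_parts b h 3 2 (fun x => b * x ^ 3 + 3 * x) Hb Hh).
  - intros x. unfold gauss. auto_derive; [trivial|simpl; unfold Rdiv; field].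
  - assert (0 <= b * h ^ 3) by (apply Rmult_le_pos; [|apply pow_le]; lra).
    replace ((- h) ^ 3) with (- h ^ 3) by ring. lra.
Qed.

Lemma gauss_moment6 b h : 0 < b -> 0 <= h ->
  RInt (fun x => x ^ 6 * gauss b x) (- h) h <= 15 / b ^ 3 * RInt (gauss b) (- h) h.
Proof.
  intros Hb Hh.
  apply (gauss_moment_by_parts b h 15 3 (fun x => b ^ 2 * x ^ 5 + 5 * b * x ^ 3 + 15 * x) Hb Hh).
  - intros x. unfold gauss. auto_derive; [trivial|simpl; unfold Rdiv; field].
  - assert (0 <= b ^ 2 * h ^ 5) by (apply Rmult_le_pos; apply pow_le; lra).
    assert (0 <= b * h ^ 3) by (apply Rmult_le_pos; [|apply pow_le]; lra).
    replace ((- h) ^ 3) with (- h ^ 3) by ring. replace ((- h) ^ 5) with (- h ^ 5) by ring. lra.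
Qed.

Lemma RInt_sym_mono (f : R -> R) a b : 0 <= a <= b -> (forall x, 0 <= f x) ->
  (forall u v, ex_RInt f u v) -> RInt f (- a) a <= RInt f (- b) b.
Proof.
  intros Hab Hf He.
  rewrite <- (RInt_Chasles f (- b) (- a) b), <- (RInt_Chasles f (- a) a b) by apply He.
  assert (0 <= RInt f (- b) (- a)) by (apply RInt_ge_0; [lra|apply He|intros; apply Hf]).
  assert (0 <= RInt f a b) by (apply RInt_ge_0; [lra|apply He|intros; apply Hf]).
  unfold plus; simpl. lra.
Qed.

(** Rescaling by [sqrt (b / V) <= 1] shrinks the interval, which may then be enlarged. This measures
    the upper Gaussian, of parameter [b], by the lower one, of parameter [V]. *)
Lemma gauss_rescale b V h H : 0 < b <= V -> 0 <= h <= H ->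
  RInt (gauss b) (- h) h <= sqrt (V / b) * RInt (gauss V) (- H) H.
Proof.
  intros Hb Hh.
  set (u := sqrt (b / V)).
  assert (Hbv : 0 < b / V) by (apply Rdiv_lt_0_compat; lra).
  assert (Hu : 0 < u) by (apply sqrt_lt_R0, Hbv).
  assert (Huu : u * u = b / V) by (apply sqrt_sqrt; lra).
  assert (Hu1 : u <= 1).
  { unfold u. rewrite <- sqrt_1. apply sqrt_le_1_alt.
    apply (Rmult_le_reg_r V); [lra|]. unfold Rdiv. rewrite Rmult_assoc, Rinv_l by lra. lra. }
  assert (E : RInt (gauss b) (- h) h = / u * RInt (gauss V) (- (u * h)) (u * h)).
  { apply is_RInt_unique.
    apply (is_RInt_ext (fun y => scal (/ u) (scal u (gauss V (u * y + 0))))).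
    - intros x _. unfold scal, mult. cbn -[pow gauss]. unfold mult. cbn -[pow gauss].
      rewrite <- Rmult_assoc, Rinv_l, Rmult_1_l by lra. unfold gauss. f_equal.
      replace ((u * x + 0) ^ 2) with (u * u * x ^ 2) by ring. rewrite Huu. field. lra.
    - apply (is_RInt_scal (V := R_NormedModule)).
      apply (is_RInt_comp_lin (V := R_NormedModule)).
      rewrite !Rplus_0_r. replace (u * - h) with (- (u * h)) by ring.
      apply (RInt_correct (V := R_CompleteNormedModule)), ex_RInt_gauss. }
  rewrite E. replace (sqrt (V / b)) with (/ u).
  2:{ unfold u. rewrite <- sqrt_inv. f_equal. field. lra. }
  apply Rmult_le_compat_l; [left; apply Rinv_0_lt_compat, Hu|].
  apply RInt_sym_mono; [nra|intros; left; apply gauss_pos|intros; apply ex_RInt_gauss].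
Qed.

Lemma gauss_integral_ge V s H : 0 < s -> V * s ^ 2 <= 1 -> 3 / 2 * s <= H ->
  15 / 8 * s <= RInt (gauss V) (- H) H.
Proof.
  intros Hs HV HH.
  apply Rle_trans with (RInt (gauss V) (- (3 / 2 * s)) (3 / 2 * s)).
  2:{ apply RInt_sym_mono; [lra|intros; left; apply gauss_pos|intros; apply ex_RInt_gauss]. }
  set (h := 3 / 2 * s) in *.
  assert (I : is_RInt (fun x => 1 - V * x ^ 2 / 2) (- h) h
    ((h - V * h ^ 3 / 6) - (- h - V * (- h) ^ 3 / 6))).
  { apply (is_RInt_derive (fun x => x - V * x ^ 3 / 6)).
    - intros x _. auto_derive; [trivial|field].
    - intros x _. apply (ex_derive_continuous (fun x => 1 - V * x ^ 2 / 2)). auto_derive. trivial. }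
  apply Rle_trans with ((h - V * h ^ 3 / 6) - (- h - V * (- h) ^ 3 / 6)).
  - replace ((- h) ^ 3) with (- h ^ 3) by ring. unfold h.
    assert (V * s ^ 2 * s <= 1 * s) by (apply Rmult_le_compat_r; lra).
    replace (V * (3 / 2 * s) ^ 3) with (27 / 8 * (V * s ^ 2 * s)) by field.
    replace (V * - (3 / 2 * s) ^ 3) with (- (27 / 8 * (V * s ^ 2 * s))) by field. lra.
  - rewrite <- (is_RInt_unique _ _ _ _ I).
    apply RInt_le; [unfold h; lra|eexists; exact I|apply ex_RInt_gauss|].
    intros x _. unfold gauss. pose proof (exp_ineq1_le (- (V * x ^ 2 / 2))). lra.
Qed.

Lemma RInt_le_const (f : R -> R) a b M : a <= b -> ex_RInt f a b ->
  (forall x, a <= x <= b -> f x <= M) -> RInt f a b <= (b - a) * M.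
Proof.
  intros Hab He Hf.
  replace ((b - a) * M) with (RInt (fun _ => M) a b).
  - apply RInt_le; [exact Hab|exact He|apply ex_RInt_const|]. intros x Hx. apply Hf. lra.
  - rewrite RInt_const. reflexivity.
Qed.

Lemma RInt_three_zones (f F : R -> R) a b c M1 M2 : 0 <= a <= b -> b <= c ->
  (forall u v, ex_RInt f u v) -> (forall u v, ex_RInt F u v) ->
  (forall x, Rabs x <= a -> f x <= F x) ->
  (forall x, a <= Rabs x <= b -> f x <= M1) ->
  (forall x, b <= Rabs x <= c -> f x <= M2) ->
  RInt f (- c) c <= RInt F (- a) a + 2 * (b - a) * M1 + 2 * (c - b) * M2.
Proof.
  intros Hab Hbc He HF H0 H1 H2.
  rewrite <- (RInt_Chasles f (- c) (- b) c), <- (RInt_Chasles f (- b) (- a) c),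
    <- (RInt_Chasles f (- a) a c), <- (RInt_Chasles f a b c) by apply He.
  unfold plus; simpl.
  assert (RInt f (- c) (- b) <= (- b - - c) * M2).
  { apply RInt_le_const; [lra|apply He|]. intros x Hx. apply H2. rewrite Rabs_left1; lra. }
  assert (RInt f b c <= (c - b) * M2).
  { apply RInt_le_const; [lra|apply He|]. intros x Hx. apply H2. rewrite Rabs_pos_eq; lra. }
  assert (RInt f (- b) (- a) <= (- a - - b) * M1).
  { apply RInt_le_const; [lra|apply He|]. intros x Hx. apply H1. rewrite Rabs_left1; lra. }
  assert (RInt f a b <= (b - a) * M1).
  { apply RInt_le_const; [lra|apply He|]. intros x Hx. apply H1. rewrite Rabs_pos_eq; lra. }
  assert (RInt f (- a) a <= RInt F (- a) a).
  { apply RInt_le; [lra|apply He|apply HF|]. intros x Hx. apply H0. apply Rabs_le. lra. }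
  lra.
Qed.

(** [exp (c y) / y ^ k] is increasing once [c y >= k]. *)
Lemma exp_ge_power c y0 y k : 0 < y0 <= y -> INR k <= c * y0 ->
  exp (c * y0) * (y / y0) ^ k <= exp (c * y).
Proof.
  intros Hy Hc.
  assert (Hk := pos_INR k).
  replace (exp (c * y)) with (exp (c * y0) * exp (c * (y - y0)))
    by (rewrite <- exp_plus; f_equal; ring).
  apply Rmult_le_compat_l; [left; apply exp_pos|].
  assert (Hr : 0 <= (y - y0) / y0) by (apply Rdiv_le_0_compat; lra).
  apply Rle_trans with (exp ((y - y0) / y0) ^ k).
  - apply pow_incr. split; [apply Rdiv_le_0_compat; lra|].
    replace (y / y0) with (1 + (y - y0) / y0) by (field; lra). apply exp_ineq1_le.
  - rewrite exp_pow. apply exp_le_compat.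
    replace (c * (y - y0)) with (c * y0 * ((y - y0) / y0)) by (field; lra).
    apply Rmult_le_compat_r; lra.
Qed.

Lemma exp_ge_square a b x : 0 <= a -> b <= a * a -> a <= exp (x / 2) -> b <= exp x.
Proof.
  intros Ha Hb H. replace (exp x) with (exp (x / 2) * exp (x / 2))
    by (rewrite <- exp_plus; f_equal; field).
  eapply Rle_trans; [exact Hb|]. apply Rmult_le_compat; lra.
Qed.

(** By monotonicity the worst case is the largest [t], where [1 / t = 10000 / 288]; [E0] is a
    rational lower bound of the exponential there. *)
Lemma exp_small t c k E0 d : 0 < t <= 288 / 10000 -> 0 < d ->
  INR k <= c * (10000 / 288) -> E0 <= exp (c * (10000 / 288)) ->
  (10000 / 288) ^ k <= d * E0 ->
  exp (- (c / t)) <= d * t ^ k.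
Proof.
  intros Ht Hd Hk HE HdE. set (y0 := 10000 / 288) in *.
  assert (Hy0 : 0 < y0) by (unfold y0; lra).
  assert (Hy : y0 <= / t).
  { replace y0 with (/ (288 / 10000)) by (unfold y0; field). apply Rinv_le_contravar; lra. }
  pose proof (exp_ge_power c y0 (/ t) k ltac:(lra) Hk) as H.
  rewrite exp_Ropp. change (c / t) with (c * / t).
  assert (Hy0k : 0 < y0 ^ k) by (apply pow_lt, Hy0).
  assert (Htk : 0 < t ^ k) by (apply pow_lt; lra).
  replace (d * t ^ k) with (/ (/ d * / t ^ k)) by (field; lra).
  apply Rinv_le_contravar; [apply Rmult_lt_0_compat; apply Rinv_0_lt_compat; lra|].
  eapply Rle_trans; [|exact H].
  replace ((/ t / y0) ^ k) with (/ t ^ k * / y0 ^ k)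
    by (unfold Rdiv; rewrite Rpow_mult_distr, !pow_inv; reflexivity).
  rewrite (Rmult_comm (/ t ^ k)), <- Rmult_assoc.
  apply Rmult_le_compat_r; [left; apply Rinv_0_lt_compat, Htk|].
  apply (Rmult_le_reg_r (d * y0 ^ k)); [apply Rmult_lt_0_compat; lra|].
  replace (/ d * (d * y0 ^ k)) with (y0 ^ k) by (field; lra).
  replace (exp (c * y0) * / y0 ^ k * (d * y0 ^ k)) with (d * exp (c * y0)) by (field; lra).
  eapply Rle_trans; [exact HdE|]. apply Rmult_le_compat_l; lra.
Qed.

Lemma exp_middle_le t : 0 < t <= 288 / 10000 ->
  exp (- (27 / 100 / t)) <= 106 / 1000 * t ^ 2.
Proof.
  intros Ht. apply (exp_small t (27 / 100) 2 11500); [exact Ht|lra|simpl; lra| |lra].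
  (* Each such line halves the exponent and gives a rational whose square is still large enough,
     until the cubic Taylor polynomial suffices. *)
  apply (exp_ge_square (2703993 / 25000)); [lra|lra|].
  apply (exp_ge_square (10399987 / 1000000)); [lra|lra|].
  apply (exp_ge_square (8062253 / 2500000)); [lra|lra|].
  apply (exp_ge_square (1795801 / 1000000)); [lra|lra|].
  apply (exp_ge_square (53603 / 40000)); [lra|lra|].
  eapply Rle_trans; [|apply exp_ge_taylor3; lra]. lra.
Qed.

Lemma exp_outer_le t : 0 < t <= 288 / 10000 ->
  exp (- (69 / 100 / t)) <= 25 / 10000 * t ^ 5.
Proof.
  intros Ht. apply (exp_small t (69 / 100) 5 22000000000); [exact Ht|lra|simpl; lra| |lra].
  apply (exp_ge_square (15632821 / 100)); [lra|lra|].
  apply (exp_ge_square (39538363 / 100000)); [lra|lra|].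
  apply (exp_ge_square (621383 / 31250)); [lra|lra|].
  apply (exp_ge_square (44591767 / 10000000)); [lra|lra|].
  apply (exp_ge_square (21116763 / 10000000)); [lra|lra|].
  apply (exp_ge_square (1816451 / 1250000)); [lra|lra|].
  eapply Rle_trans; [|apply exp_ge_taylor3; lra]. lra.
Qed.

(** * The saddle point estimate *)

Lemma variance_le_numeric t N : 0 < t <= 288 / 10000 -> variance t N <= 334 / 100 / t ^ 3.
Proof.
  intros Ht.
  assert (Ht3 : 0 < t ^ 3) by (apply pow_lt; lra).
  (* [cosh 0.0864 <= 1.0076], and [2 (1.0076 * 1.4914 + 1/6) < 3.34], near the limit
     [2 zeta(2) = 3.29]. *)
  eapply Rle_trans; [apply (variance_le 6 (10076 / 10000)); [lia|lra|]|].
  - intros k Hk. pose proof (INR_ge1 k (proj1 Hk)).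
    assert (INR k <= 6) by (pose proof (le_INR k 6 ltac:(lia)) as L; simpl in L; lra).
    assert (0 < INR k * t <= 6 * (288 / 10000)) by nra.
    eapply Rle_trans; [apply twocosh_le; lra|].
    set (a := INR k * t / 2). assert (0 < a <= 864 / 10000) by (unfold a; lra).
    apply (Rmult_le_reg_r (1 - a ^ 2)); [nra|].
    unfold Rdiv at 1. rewrite Rmult_assoc, Rinv_l by nra. nra.
  - apply Rmult_le_compat_r; [left; apply Rinv_0_lt_compat, Ht3|]. simpl. lra.
Qed.

Lemma mean_le_numeric t N : 0 < t -> mean t N <= 16498 / 10000 / t ^ 2.
Proof.
  intros Ht. eapply Rle_trans; [apply (mean_le 10); [lia|exact Ht]|].
  apply Rmult_le_compat_r; [left; apply Rinv_0_lt_compat, pow_lt, Ht|]. simpl. lra.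
Qed.

Section Saddle.
Variables (t : R) (N n : nat).
Hypothesis Ht : 0 < t <= 288 / 10000.
Hypothesis Htail : exp (- (INR N * t)) / t <= / 2000.
Hypothesis Hmean : mean t N = INR n.

Let g := modulus t N.
Let psi (theta : R) := phase t N theta - INR n * theta.
Let V := 334 / 100 / t ^ 3.
Let b := 216 / 100 / t ^ 3.
(** The common unit: [A0] bounds the integral of [g] from below, and all error integrals are bounded
    by multiples of it. *)
Let A0 : R := RInt (gauss V) (- PI) PI.
Let u : R := RInt (fun x => g x * cos (psi x)) (- PI) PI.
Let C : R := RInt (fun x => g x * (cos (psi x) * cos x)) (- PI) PI.
Let S : R := RInt (fun x => g x * (sin (psi x) * sin x)) (- PI) PI.
Let B : R := RInt (fun x => g x * (1 - cos x)) (- PI) PI.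
Let E : R := RInt (fun x => g x * (1 - cos (psi x))) (- PI) PI.

Let t_pos : 0 < t := proj1 Ht.

Let t3_pos : 0 < t ^ 3.
Proof. apply pow_lt, t_pos. Qed.

Let b_pos : 0 < b.
Proof. apply Rdiv_lt_0_compat; [lra|exact t3_pos]. Qed.

Let g_pos x : 0 < g x.
Proof. apply modulus_pos, t_pos. Qed.

Let g_derive x : ex_derive g x.
Proof. apply ex_derive_modulus, t_pos. Qed.

Let psi_derive x : ex_derive psi x.
Proof.
  apply @ex_derive_minus; [apply ex_derive_phase, t_pos|]. auto_derive. trivial.
Qed.

Let ex_mul (h : R -> R) : (forall x, ex_derive h x) -> forall c d, ex_RInt (fun x => g x * h x) c d.
Proof.
  intros Hh c d. apply ex_RInt_of_derive. intros x. apply @ex_derive_mult; [apply g_derive|apply Hh].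
Qed.

Ltac solve_ex := apply ex_mul; let x := fresh "x" in intros x;
  pose proof (psi_derive x); auto_derive; tauto.

Let psi_bound x : Rabs (psi x) <= 2112 / 1000 / t ^ 4 * Rabs x ^ 3.
Proof.
  pose proof (phase_bound t N x t_pos) as H. rewrite Hmean in H. fold (psi x) in H.
  eapply Rle_trans; [exact H|]. pose proof (cumulant3_le t N Ht) as Hk.
  assert (H3 : 0 <= Rabs x ^ 3) by (apply pow_le, Rabs_pos).
  apply Rle_trans with (1267 / 100 / t ^ 4 * Rabs x ^ 3 / 6).
  - unfold Rdiv at 1 4. apply Rmult_le_compat_r; [lra|]. apply Rmult_le_compat_r; assumption.
  - replace (1267 / 100 / t ^ 4 * Rabs x ^ 3 / 6) with (1267 / 600 / t ^ 4 * Rabs x ^ 3)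
      by (field; lra).
    apply Rmult_le_compat_r; [assumption|].
    apply Rmult_le_compat_r; [left; apply Rinv_0_lt_compat, pow_lt, t_pos|lra].
Qed.

(** The true order is [t ^ (3/2)]; this weaker bound gives positivity and absorbs the exponentially
    small zones. With [s = 3.2 t ^ 2], [V s ^ 2] is about [34.2 t], below 1. *)
Let A0_ge : 6 * t ^ 2 <= A0.
Proof.
  assert (Ht2 : 0 < t ^ 2) by (apply pow_lt; lra).
  apply Rle_trans with (15 / 8 * (32 / 10 * t ^ 2)); [lra|].
  apply gauss_integral_ge; [lra| |pose proof PI_RGT_0; pose proof PI2_1; nra].
  unfold V. replace (334 / 100 / t ^ 3 * (32 / 10 * t ^ 2) ^ 2) with (334 / 100 * (1024 / 100) * t)
    by (field; lra). lra.
Qed.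

Let Q_le : RInt (gauss b) (- (t / 2)) (t / 2) <= 12436 / 10000 * A0.
Proof.
  eapply Rle_trans; [apply (gauss_rescale b V (t / 2) PI)|].
  - split; [exact b_pos|]. unfold b, V.
    apply Rmult_le_compat_r; [left; apply Rinv_0_lt_compat, t3_pos|lra].
  - pose proof PI2_1. lra.
  - apply Rmult_le_compat_r.
    + pose proof A0_ge. pose proof (pow2_ge_0 t). fold A0. lra.
    + rewrite <- (sqrt_pow2 (12436 / 10000)) by lra. apply sqrt_le_1_alt.
      unfold V, b. replace (334 / 100 / t ^ 3 / (216 / 100 / t ^ 3)) with (334 / 216) by (field; lra).
      lra.
Qed.

(* The three zones are [|x| <= t/2], [t/2 <= |x| <= 3t/2] and [3t/2 <= |x| <= PI]. *)
Let zones (h : R -> R) (c M1 M2 : R) (k : nat) :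
  (forall x, ex_derive h x) -> 0 <= M1 -> 0 <= M2 ->
  (forall x, h x <= c * x ^ k) ->
  (forall x, Rabs x <= 3 / 2 * t -> h x <= M1) ->
  (forall x, h x <= M2) ->
  0 <= c -> Nat.even k = true ->
  RInt (fun x => g x * h x) (- PI) PI <=
    1002 / 1000 * c * RInt (fun x => x ^ k * gauss b x) (- (t / 2)) (t / 2)
    + (106 / 1000 * 1002 / 1000 * 2 * t ^ 3 * M1 + 21 / 1000 * t ^ 5 * M2).
Proof.
  intros Hh HM1 HM2 Hmaj Hmid Hout Hc Hk.
  assert (Hxk : forall x, 0 <= x ^ k).
  { intros x. apply Nat.even_spec in Hk. destruct Hk as [j ->].
    rewrite pow_mult. apply pow_le, pow2_ge_0. }
  assert (P5 : 0 < t ^ 5) by (apply pow_lt, t_pos).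
  pose proof PI_4 as HPI4. pose proof PI2_1 as HPI.
  assert (X : ex_RInt (fun x => x ^ k * gauss b x) (- (t / 2)) (t / 2)).
  { apply ex_RInt_of_derive. intros x. unfold gauss. auto_derive. trivial. }
  assert (EQ : RInt (fun x => 1002 / 1000 * c * (x ^ k * gauss b x)) (- (t / 2)) (t / 2)
    = 1002 / 1000 * c * RInt (fun x => x ^ k * gauss b x) (- (t / 2)) (t / 2)).
  { apply is_RInt_unique. apply (is_RInt_scal (V := R_NormedModule)).
    apply (RInt_correct (V := R_CompleteNormedModule)), X. }
  assert (Z : RInt (fun x => g x * h x) (- PI) PI <=
    RInt (fun x => 1002 / 1000 * c * (x ^ k * gauss b x)) (- (t / 2)) (t / 2)
    + 2 * (3 / 2 * t - t / 2) * (1002 / 1000 * (106 / 1000 * t ^ 2) * M1)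
    + 2 * (PI - 3 / 2 * t) * (1002 / 1000 * (25 / 10000 * t ^ 5) * M2)).
  { apply RInt_three_zones; [lra|lra|apply ex_mul, Hh|intros; apply ex_RInt_gauss_mul| | |].
    - intros x Hx. pose proof (modulus_le_major t N x Ht Htail Hx) as H. fold b in H.
      apply Rle_trans with (g x * (c * x ^ k)).
      + apply Rmult_le_compat_l; [left; apply g_pos|apply Hmaj].
      + replace (1002 / 1000 * c * (x ^ k * gauss b x)) with (1002 / 1000 * gauss b x * (c * x ^ k)) by ring.
        apply Rmult_le_compat_r; [apply Rmult_le_pos; [exact Hc|apply Hxk]|exact H].
    - intros x Hx. pose proof (modulus_le_middle t N x Ht Htail Hx) as H.
      pose proof (exp_middle_le t Ht) as H1.
      apply Rle_trans with (g x * M1).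
      + apply Rmult_le_compat_l; [left; apply g_pos|apply Hmid; lra].
      + apply Rmult_le_compat_r; [exact HM1|]. unfold g. lra.
    - intros x Hx. pose proof (modulus_le_outer t N x Ht Htail Hx) as H.
      pose proof (exp_outer_le t Ht) as H1.
      apply Rle_trans with (g x * M2).
      + apply Rmult_le_compat_l; [left; apply g_pos|apply Hout; lra].
      + apply Rmult_le_compat_r; [exact HM2|]. unfold g. lra. }
  rewrite EQ in Z. eapply Rle_trans; [exact Z|].
  assert (T : 0 <= t ^ 5 * M2) by (apply Rmult_le_pos; lra).
  (* [PI <= 4] is enough: [2 * 4 * 1.002 * 0.0025 < 0.021]. *)
  assert (2 * (PI - 3 / 2 * t) * (1002 / 1000 * (25 / 10000 * t ^ 5) * M2) <= 21 / 1000 * t ^ 5 * M2).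
  { replace (2 * (PI - 3 / 2 * t) * (1002 / 1000 * (25 / 10000 * t ^ 5) * M2))
      with ((PI - 3 / 2 * t) * (501 / 100000) * (t ^ 5 * M2)) by field.
    replace (21 / 1000 * t ^ 5 * M2) with (21 / 1000 * (t ^ 5 * M2)) by ring.
    apply Rmult_le_compat_r; [exact T|].
    lra. }
  replace (2 * (3 / 2 * t - t / 2) * (1002 / 1000 * (106 / 1000 * t ^ 2) * M1))
    with (106 / 1000 * 1002 / 1000 * 2 * t ^ 3 * M1) by field. lra.
Qed.

(** The central zone gives [1.002 / 2 * 1.2436 / 2.16], about 0.2885. The other zones are of order
    [t ^ 5], at most [0.047 t ^ 3 A0] by [A0_ge]. *)
Let B_le : B <= 3355 / 10000 * t ^ 3 * A0.
Proof.
  pose proof (zones (fun x => 1 - cos x) (1 / 2) (9 / 8 * t ^ 2) 2 2) as H.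
  assert (Ht2 : 0 < t ^ 2) by (apply pow_lt, t_pos).
  eapply Rle_trans; [apply H|].
  - intros x. auto_derive. trivial.
  - lra.
  - lra.
  - intros x. pose proof (one_minus_cos_le x). lra.
  - intros x Hx. pose proof (one_minus_cos_le x). rewrite <- (pow2_abs x) in H0.
    pose proof (Rabs_pos x). nra.
  - intros x. pose proof (COS_bound x). lra.
  - lra.
  - reflexivity.
  - pose proof (gauss_moment2 b (t / 2) b_pos ltac:(lra)) as M.
    assert (Eb : / b = 100 / 216 * t ^ 3) by (unfold b; field; lra). rewrite Eb in M.
    assert (X : 100 / 216 * t ^ 3 * RInt (gauss b) (- (t / 2)) (t / 2)
       <= 100 / 216 * t ^ 3 * (12436 / 10000 * A0)) by (apply Rmult_le_compat_l; [lra|exact Q_le]).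
    assert (Y : t ^ 3 * (6 * t ^ 2) <= t ^ 3 * A0) by (apply Rmult_le_compat_l; [lra|exact A0_ge]).
    replace (t ^ 3 * (6 * t ^ 2)) with (6 * t ^ 5) in Y by ring.
    replace (106 / 1000 * 1002 / 1000 * 2 * t ^ 3 * (9 / 8 * t ^ 2))
      with (106 / 1000 * 1002 / 1000 * 2 * 9 / 8 * t ^ 5) by field.
    nra.
Qed.

(** [x] has scale [t ^ (3/2)], so [psi] is of order [t ^ (1/2)] and [E / A0] of order [t], through
    the sixth moment; the constant is for the largest [t]. *)
Let E_le : E <= 1213 / 10000 * A0.
Proof.
  set (K := 2112 / 1000 / t ^ 4).
  assert (Ht4 : 0 < t ^ 4) by (apply pow_lt, t_pos).
  assert (HK : 0 < K) by (unfold K; apply Rdiv_lt_0_compat; lra).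
  pose proof (zones (fun x => 1 - cos (psi x)) (K ^ 2 / 2) 2 2 6) as H.
  eapply Rle_trans; [apply H|].
  - intros x. pose proof (psi_derive x). auto_derive. tauto.
  - lra.
  - lra.
  - intros x. eapply Rle_trans; [apply one_minus_cos_le|].
    rewrite <- (pow2_abs (psi x)).
    replace (K ^ 2 / 2 * x ^ 6) with ((K * Rabs x ^ 3) ^ 2 / 2).
    + apply Rmult_le_compat_r; [lra|]. apply pow_incr. split; [apply Rabs_pos|apply psi_bound].
    + replace (x ^ 6) with ((x ^ 2) ^ 3) by ring. rewrite <- (pow2_abs x). field.
  - intros x _. pose proof (COS_bound (psi x)). lra.
  - intros x. pose proof (COS_bound (psi x)). lra.
  - assert (0 < K ^ 2) by (apply pow_lt, HK). lra.
  - reflexivity.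
  - pose proof (gauss_moment6 b (t / 2) b_pos ltac:(lra)) as M.
    assert (Ht2 : 0 < t ^ 2) by (apply pow_lt, t_pos).
    set (M6 := RInt (fun x => x ^ 6 * gauss b x) (- (t / 2)) (t / 2)) in *.
    set (Q := RInt (gauss b) (- (t / 2)) (t / 2)) in *.
    assert (X : 1002 / 1000 * (K ^ 2 / 2) * M6 <= 1002 / 1000 * (K ^ 2 / 2) * (15 / b ^ 3 * (12436 / 10000 * A0))).
    { apply Rmult_le_compat_l.
      - assert (0 < K ^ 2) by (apply pow_lt, HK). lra.
      - eapply Rle_trans; [exact M|]. apply Rmult_le_compat_l; [|exact Q_le].
        left. apply Rdiv_lt_0_compat; [lra|]. apply pow_lt, b_pos. }
    replace (1002 / 1000 * (K ^ 2 / 2) * (15 / b ^ 3 * (12436 / 10000 * A0)))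
      with (1002 / 1000 / 2 * (2112 / 1000) ^ 2 * 15 / (216 / 100) ^ 3 * (12436 / 10000) * (t * A0)) in X
      by (unfold K, b; field; lra).
    pose proof A0_ge as HA.
    assert (Y : t * (6 * t ^ 2) <= t * A0) by (apply Rmult_le_compat_l; lra).
    replace (t * (6 * t ^ 2)) with (6 * t ^ 3) in Y by ring.
    assert (Z : t * A0 <= 288 / 10000 * A0) by (apply Rmult_le_compat_r; lra).
    assert (W : t ^ 5 <= t ^ 3 / 1000).
    { replace (t ^ 5) with (t ^ 3 * t ^ 2) by ring. assert (t ^ 2 <= / 1000) by nra. nra. }
    lra.
Qed.

(** At the same scale [x psi(x)] is of order [t ^ 2], through the fourth moment. [zones] bounds only
    from above, hence the sign [s]. *)
Let S_le_aux (s : R) : s = 1 \/ s = -1 ->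
  RInt (fun x => g x * (s * (sin (psi x) * sin x))) (- PI) PI <= 1747 / 1000 * t ^ 2 * A0.
Proof.
  intros Hs. set (K := 2112 / 1000 / t ^ 4).
  assert (Ht4 : 0 < t ^ 4) by (apply pow_lt, t_pos).
  assert (Ht2 : 0 < t ^ 2) by (apply pow_lt, t_pos).
  assert (HK : 0 < K) by (unfold K; apply Rdiv_lt_0_compat; lra).
  assert (Hsin : forall z, Rabs (sin z) <= 1) by (intros z; apply Rabs_le, SIN_bound).
  assert (Hsinx : forall z, Rabs (sin z) <= Rabs z).
  { assert (P : forall z, 0 <= z -> Rabs (sin z) <= z).
    { intros z Hz. destruct (Req_dec z 0) as [->|]; [rewrite sin_0, Rabs_R0; lra|].
      destruct (Rle_dec z PI).
      - rewrite Rabs_pos_eq by (apply sin_ge_0; lra). pose proof (sin_lt_x z). lra.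
      - pose proof (Hsin z). pose proof PI2_1. lra. }
    intros z. destruct (Rle_dec 0 z); [rewrite (Rabs_pos_eq z) by lra; apply P; lra|].
    rewrite <- Rabs_Ropp, <- sin_neg, (Rabs_left z) by lra. apply P. lra. }
  assert (Hle : forall x, s * (sin (psi x) * sin x) <= Rabs (sin (psi x)) * Rabs (sin x)).
  { intros x. rewrite <- Rabs_mult. pose proof (Rle_abs (sin (psi x) * sin x)).
    pose proof (Rle_abs (- (sin (psi x) * sin x))) as H1. rewrite Rabs_Ropp in H1.
    destruct Hs as [-> | ->]; lra. }
  pose proof (zones (fun x => s * (sin (psi x) * sin x)) K (3 / 2 * t) 1 4) as H.
  eapply Rle_trans; [apply H|].
  - intros x. pose proof (psi_derive x). auto_derive. tauto.
  - lra.
  - lra.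
  - intros x. eapply Rle_trans; [apply Hle|].
    replace (K * x ^ 4) with (K * Rabs x ^ 3 * Rabs x).
    + apply Rmult_le_compat; [apply Rabs_pos|apply Rabs_pos| |apply Hsinx].
      eapply Rle_trans; [apply Hsinx|apply psi_bound].
    + replace (x ^ 4) with ((x ^ 2) ^ 2) by ring. rewrite <- (pow2_abs x). ring.
  - intros x Hx. eapply Rle_trans; [apply Hle|]. rewrite <- (Rmult_1_l (3 / 2 * t)).
    apply Rmult_le_compat; [apply Rabs_pos|apply Rabs_pos|apply Hsin|].
    eapply Rle_trans; [apply Hsinx|exact Hx].
  - intros x. eapply Rle_trans; [apply Hle|]. rewrite <- (Rmult_1_l 1).
    apply Rmult_le_compat; [apply Rabs_pos|apply Rabs_pos|apply Hsin|apply Hsin].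
  - lra.
  - reflexivity.
  - pose proof (gauss_moment4 b (t / 2) b_pos ltac:(lra)) as M.
    set (M4 := RInt (fun x => x ^ 4 * gauss b x) (- (t / 2)) (t / 2)) in *.
    set (Q := RInt (gauss b) (- (t / 2)) (t / 2)) in *.
    assert (X : 1002 / 1000 * K * M4 <= 1002 / 1000 * K * (3 / b ^ 2 * (12436 / 10000 * A0))).
    { apply Rmult_le_compat_l; [lra|].
      eapply Rle_trans; [exact M|]. apply Rmult_le_compat_l; [|exact Q_le].
      left. apply Rdiv_lt_0_compat; [lra|]. apply pow_lt, b_pos. }
    replace (1002 / 1000 * K * (3 / b ^ 2 * (12436 / 10000 * A0)))
      with (1002 / 1000 * (2112 / 1000) * 3 / (216 / 100) ^ 2 * (12436 / 10000) * (t ^ 2 * A0)) in X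
      by (unfold K, b; field; lra).
    pose proof A0_ge as HA.
    assert (Y : t ^ 2 * (6 * t ^ 2) <= t ^ 2 * A0) by (apply Rmult_le_compat_l; lra).
    replace (t ^ 2 * (6 * t ^ 2)) with (6 * t ^ 4) in Y by ring.
    assert (W : t ^ 5 <= 288 / 10000 * t ^ 4).
    { replace (t ^ 5) with (t * t ^ 4) by ring. apply Rmult_le_compat_r; lra. }
    replace (106 / 1000 * 1002 / 1000 * 2 * t ^ 3 * (3 / 2 * t))
      with (106 / 1000 * 1002 / 1000 * 3 * t ^ 4) by field.
    lra.
Qed.

Let S_sq_le : S ^ 2 <= (1747 / 1000 * t ^ 2 * A0) ^ 2.
Proof.
  pose proof (S_le_aux 1 (or_introl eq_refl)) as H1.
  pose proof (S_le_aux (-1) (or_intror eq_refl)) as H2.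
  assert (X : ex_RInt (fun x => g x * (sin (psi x) * sin x)) (- PI) PI) by solve_ex.
  assert (E1 : RInt (fun x => g x * (1 * (sin (psi x) * sin x))) (- PI) PI = S).
  { apply RInt_ext. intros x _. rewrite Rmult_1_l. reflexivity. }
  assert (E2 : RInt (fun x => g x * (-1 * (sin (psi x) * sin x))) (- PI) PI = - S).
  { apply is_RInt_unique.
    apply (is_RInt_ext (fun x => opp (g x * (sin (psi x) * sin x)))).
    - intros x _. unfold opp; simpl. ring.
    - apply (is_RInt_opp (V := R_NormedModule)), (RInt_correct (V := R_CompleteNormedModule)), X. }
  rewrite E1 in H1. rewrite E2 in H2. nra.
Qed.

Let u_ge : 8787 / 10000 * A0 <= u.
Proof.
  assert (HA : A0 <= RInt g (- PI) PI).
  { apply RInt_le; [pose proof PI_RGT_0; lra|apply ex_RInt_gauss|apply ex_RInt_of_derive, g_derive|].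
    intros x _. eapply Rle_trans; [|apply modulus_ge, t_pos]. apply exp_le_compat.
    pose proof (variance_le_numeric t N Ht) as HV. fold V in HV. pose proof (pow2_ge_0 x). nra. }
  assert (Eu : u = RInt g (- PI) PI - E).
  { apply is_RInt_unique.
    apply (is_RInt_ext (fun x => minus (g x) (g x * (1 - cos (psi x))))).
    - intros x _. unfold minus, plus, opp; simpl. ring.
    - apply (is_RInt_minus (V := R_NormedModule)); apply (RInt_correct (V := R_CompleteNormedModule)).
      + apply ex_RInt_of_derive, g_derive.
      + solve_ex. }
  pose proof E_le. lra.
Qed.

Let uC_le : u - C <= B.
Proof.
  assert (E1 : u - C = RInt (fun x => g x * (cos (psi x) * (1 - cos x))) (- PI) PI).
  { symmetry. apply is_RInt_unique.
    apply (is_RInt_ext (fun x => minus (g x * cos (psi x)) (g x * (cos (psi x) * cos x)))).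
    - intros x _. unfold minus, plus, opp; simpl. ring.
    - apply (is_RInt_minus (V := R_NormedModule)); apply (RInt_correct (V := R_CompleteNormedModule)); solve_ex. }
  rewrite E1. apply RInt_le; [pose proof PI_RGT_0; lra|solve_ex| |].
  - apply ex_mul. intros x. auto_derive. trivial.
  - intros x _. apply Rmult_le_compat_l; [left; apply g_pos|].
    pose proof (COS_bound x). pose proof (COS_bound (psi x)). nra.
Qed.

(** [2 * 0.3355 / 0.8787] and [(1.747 / 0.8787) ^ 2 * 0.0288] add up to less than 0.89. The margin
    up to 0.963 covers the passage from a gap relative to [u ^ 2] to one relative to the product. *)
Lemma fourier_log_concavity_gap :
  0 < fourier t N (Z.of_nat n) /\
  fourier t N (Z.of_nat n) ^ 2 <
    (1 + 963 / 1000 * t ^ 3) * (fourier t N (Z.of_nat n - 1) * fourier t N (Z.of_nat n + 1)).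
Proof.
  assert (Eu : fourier t N (Z.of_nat n) = u).
  { apply RInt_ext. intros x _. rewrite <- INR_IZR_INZ. reflexivity. }
  assert (Em : fourier t N (Z.of_nat n - 1) = C - S).
  { apply is_RInt_unique.
    apply (is_RInt_ext (fun x => minus (g x * (cos (psi x) * cos x)) (g x * (sin (psi x) * sin x)))).
    - intros x _. rewrite minus_IZR, <- INR_IZR_INZ.
      replace (phase t N x - (INR n - 1) * x) with (psi x + x) by (unfold psi; ring).
      rewrite cos_plus. unfold minus, plus, opp, g; simpl. ring.
    - apply (is_RInt_minus (V := R_NormedModule)); apply (RInt_correct (V := R_CompleteNormedModule)); solve_ex. }
  assert (Ep : fourier t N (Z.of_nat n + 1) = C + S).
  { apply is_RInt_unique.
    apply (is_RInt_ext (fun x => plus (g x * (cos (psi x) * cos x)) (g x * (sin (psi x) * sin x)))).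
    - intros x _. rewrite plus_IZR, <- INR_IZR_INZ.
      replace (phase t N x - (INR n + 1) * x) with (psi x - x) by (unfold psi; ring).
      rewrite cos_minus. unfold plus, g; simpl. ring.
    - apply (is_RInt_plus (V := R_NormedModule)); apply (RInt_correct (V := R_CompleteNormedModule)); solve_ex. }
  rewrite Eu, Em, Ep.
  assert (Ht2 : 0 < t ^ 2) by (apply pow_lt, t_pos).
  pose proof A0_ge as HA. pose proof u_ge as Hu.
  assert (Hu0 : 0 < u) by lra. split; [exact Hu0|].
  assert (HAu : A0 <= 10000 / 8787 * u) by lra.
  assert (HB : u - C <= 3355 / 10000 * (10000 / 8787) * t ^ 3 * u).
  { eapply Rle_trans; [exact uC_le|]. eapply Rle_trans; [exact B_le|].
    assert (t ^ 3 * A0 <= t ^ 3 * (10000 / 8787 * u)) by (apply Rmult_le_compat_l; lra). lra. }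
  assert (HS : S ^ 2 <= (1747 / 1000 * (10000 / 8787)) ^ 2 * (288 / 10000) * t ^ 3 * u ^ 2).
  { eapply Rle_trans; [exact S_sq_le|].
    apply Rle_trans with ((1747 / 1000 * t ^ 2 * (10000 / 8787 * u)) ^ 2).
    - apply pow_incr. split; [repeat apply Rmult_le_pos; lra|].
      apply Rmult_le_compat_l; lra.
    - replace ((1747 / 1000 * t ^ 2 * (10000 / 8787 * u)) ^ 2)
        with ((1747 / 1000 * (10000 / 8787)) ^ 2 * t * (t ^ 3 * u ^ 2)) by ring.
      replace ((1747 / 1000 * (10000 / 8787)) ^ 2 * (288 / 10000) * t ^ 3 * u ^ 2)
        with ((1747 / 1000 * (10000 / 8787)) ^ 2 * (288 / 10000) * (t ^ 3 * u ^ 2)) by ring.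
      assert (0 <= t ^ 3 * u ^ 2) by (apply Rmult_le_pos; [lra|apply pow2_ge_0]).
      apply Rmult_le_compat_r; [assumption|]. lra. }
  assert (HD : u ^ 2 - (C - S) * (C + S) <= 2 * u * (u - C) + S ^ 2).
  { pose proof (pow2_ge_0 (u - C)). lra. }
  assert (HD2 : u ^ 2 - (C - S) * (C + S) <= 89 / 100 * t ^ 3 * u ^ 2).
  { eapply Rle_trans; [exact HD|].
    assert (2 * u * (u - C) <= 2 * u * (3355 / 10000 * (10000 / 8787) * t ^ 3 * u))
      by (apply Rmult_le_compat_l; lra).
    assert (0 <= t ^ 3 * u ^ 2) by (apply Rmult_le_pos; [lra|apply pow2_ge_0]).
    replace (2 * u * (3355 / 10000 * (10000 / 8787) * t ^ 3 * u))
      with (2 * (3355 / 8787) * (t ^ 3 * u ^ 2)) in H by field.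
    lra. }
  assert (Ht3 : t ^ 3 <= / 10000) by (simpl; nra).
  set (D := u ^ 2 - (C - S) * (C + S)) in *.
  replace ((C - S) * (C + S)) with (u ^ 2 - D) by (unfold D; ring).
  assert (Hu2 : 0 < u ^ 2) by (apply pow_lt, Hu0).
  assert (Htu : 0 < t ^ 3 * u ^ 2) by (apply Rmult_lt_0_compat; lra).
  assert ((1 + 963 / 1000 * t ^ 3) * D <= (1 + 963 / 1000 * t ^ 3) * (89 / 100 * t ^ 3 * u ^ 2))
    by (apply Rmult_le_compat_l; lra).
  assert (963 / 1000 * t ^ 3 * (t ^ 3 * u ^ 2) <= 963 / 1000 * / 10000 * (t ^ 3 * u ^ 2))
    by (apply Rmult_le_compat_r; lra).
  lra.
Qed.
End Saddle.

(** * Existence of the saddle point and the case of large [n] *)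

Lemma ex_derive_mean N t : 0 < t -> ex_derive (fun t => mean t N) t.
Proof.
  intros Ht. unfold mean. induction N as [|N IH].
  { apply (ex_derive_ext (fun _ => 0)); [reflexivity|apply ex_derive_const]. }
  pose proof (rho_bounds t (S N) Ht ltac:(lia)) as Hr.
  apply (ex_derive_plus (fun t => psum (fun m => INR m * (rho t m / (1 - rho t m))) N)); [exact IH|].
  unfold rho in *. set (n := INR (S N)) in *. auto_derive. lra.
Qed.

Lemma mean_ge t N : 0 < t -> (1 <= N)%nat -> / t - 1 <= mean t N.
Proof.
  intros Ht HN. destruct N as [|N]; [lia|]. clear HN. unfold mean.
  assert (H1 : / t - 1 <= INR 1 * (rho t 1 / (1 - rho t 1))).
  { pose proof (rho_bounds t 1 Ht ltac:(lia)) as Hr.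
    assert (Hq : 1 - t <= rho t 1).
    { unfold rho. simpl INR. pose proof (exp_ineq1_le (- (1 * t))). lra. }
    set (r := rho t 1) in *. simpl INR. rewrite Rmult_1_l.
    assert (/ t <= / (1 - r)) by (apply Rinv_le_contravar; lra).
    replace (r / (1 - r)) with (/ (1 - r) - 1) by (field; lra). lra. }
  induction N as [|N IH].
  - cbn [psum]. lra.
  - eapply Rle_trans; [exact IH|]. change (psum ?f (S (S N))) with (psum f (S N) + f (S (S N))).
    pose proof (rho_bounds t (S (S N)) Ht ltac:(lia)) as Hr.
    assert (0 <= INR (S (S N)) * (rho t (S (S N)) / (1 - rho t (S (S N))))); [|lra].
    apply Rmult_le_pos; [apply pos_INR|]. apply Rdiv_le_0_compat; lra.
Qed.

(** Intermediate values: at [1 / (n + 2)] the mean is at least [n + 1], at [sqrt (1.65 / n)] at most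
    [1.6498 / 1.65 * n]. Neither end depends on [N], so [N] can be fixed beforehand; the weak lower
    bound on [t] serves to control the tail in [N]. *)
Lemma saddle_point_exists n N : (1 <= n)%nat -> (1 <= N)%nat ->
  exists t, / (INR n + 2) <= t /\ INR n * t ^ 2 <= 165 / 100 /\ mean t N = INR n.
Proof.
  intros Hn HN. pose proof (INR_ge1 n Hn) as Hn'.
  set (a := / (INR n + 2)). set (b := sqrt (165 / 100 / INR n)).
  assert (Ha : 0 < a) by (apply Rinv_0_lt_compat; lra).
  assert (Hb2 : b ^ 2 = 165 / 100 / INR n).
  { unfold b. rewrite pow2_sqrt; [reflexivity|]. apply Rdiv_le_0_compat; lra. }
  assert (Hb : 0 < b) by (apply sqrt_lt_R0, Rdiv_lt_0_compat; lra).
  assert (Hab : a < b).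
  { apply Rsqr_incrst_0; [|lra|lra]. unfold Rsqr.
    replace (b * b) with (165 / 100 / INR n) by (rewrite <- Hb2; ring).
    unfold a. apply Rle_lt_trans with (1 / INR n).
    - replace (/ (INR n + 2) * / (INR n + 2)) with (1 / ((INR n + 2) * (INR n + 2))) by (field; lra).
      apply div_le_div; nra.
    - apply Rmult_lt_compat_r; [apply Rinv_0_lt_compat|]; lra. }
  destruct (IVT_interv (fun t => INR n - mean t N) a b) as [t [Htab Ht]]; [| exact Hab | | |].
  - intros x Hx. apply continuity_pt_filterlim.
    apply (ex_derive_continuous (fun t => INR n - mean t N)).
    apply @ex_derive_minus; [apply ex_derive_const|apply ex_derive_mean; lra].
  - pose proof (mean_ge a N Ha HN) as H.
    replace (/ a) with (INR n + 2) in H by (unfold a; field; lra). lra.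
  - pose proof (mean_le_numeric b N Hb) as H. rewrite Hb2 in H.
    replace (16498 / 10000 / (165 / 100 / INR n)) with (16498 / 16500 * INR n) in H by (field; lra).
    lra.
  - exists t. split; [apply Htab|split; [|lra]].
    assert (t ^ 2 <= b ^ 2) by (apply pow_incr; lra). rewrite Hb2 in H.
    apply Rle_trans with (INR n * (165 / 100 / INR n)).
    + apply Rmult_le_compat_l; lra.
    + right. field. lra.
Qed.

Lemma Rpower_three_halves x : 0 < x -> Rpower x (3 / 2) = x * sqrt x.
Proof.
  intros Hx. replace (3 / 2) with (1 + / 2) by field.
  rewrite Rpower_plus, Rpower_1, Rpower_sqrt by lra. reflexivity.
Qed.

(** The origin of 0.963: [24 * 1.65 = 39.6] and [0.963 * 39.6 ^ (3/2) < 240]. *)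
Lemma gap_constant_ge n t : 0 < n -> 0 < t -> n * t ^ 2 <= 165 / 100 ->
  963 / 1000 * t ^ 3 <= 240 / Rpower (24 * n) (3 / 2).
Proof.
  intros Hn Ht H. rewrite Rpower_three_halves by lra.
  set (y := 24 * n). assert (Hy : 0 < y) by (unfold y; lra).
  assert (Hyt : y * t ^ 2 <= 396 / 10) by (unfold y; lra).
  assert (Hs : 0 < sqrt y) by (apply sqrt_lt_R0, Hy).
  assert (Hst : sqrt y * t <= 62929 / 10000).
  { rewrite <- (sqrt_pow2 t) by lra.
    rewrite <- sqrt_mult by (try lra; apply pow2_ge_0).
    rewrite <- (sqrt_pow2 (62929 / 10000)) by lra. apply sqrt_le_1_alt. lra. }
  assert (Hd : 0 < y * sqrt y) by (apply Rmult_lt_0_compat; lra).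
  apply (Rmult_le_reg_r (y * sqrt y)); [exact Hd|].
  replace (240 / (y * sqrt y) * (y * sqrt y)) with 240 by (field; lra).
  replace (963 / 1000 * t ^ 3 * (y * sqrt y)) with (963 / 1000 * ((y * t ^ 2) * (sqrt y * t))) by ring.
  assert (y * t ^ 2 * (sqrt y * t) <= 396 / 10 * (62929 / 10000)).
  { apply Rmult_le_compat; try lra; apply Rmult_le_pos; try lra. apply pow2_ge_0. }
  lra.
Qed.

Lemma partition_gap_large n : (2000 <= n)%nat ->
  0 < INR (partition_number n) /\
  INR (partition_number n) ^ 2 < (1 + 240 / Rpower (24 * INR n) (3 / 2)) *
    (INR (partition_number (n - 1)) * INR (partition_number (n + 1))).
Proof.
  intros Hn.
  (* With [t >= 1 / (n + 2)] the cube gives [N t ^ 2 >= n + 2], hence [exp (- N t) / t <= 1 / (N t ^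
     2) <= 1 / 2000]. *)
  set (N := ((n + 2) ^ 3)%nat).
  assert (HN : (n + 2 <= N)%nat) by (unfold N; simpl; nia).
  destruct (saddle_point_exists n N ltac:(lia) ltac:(lia)) as [t [Hta [Htb Hm]]].
  assert (Hn' : 2000 <= INR n) by (pose proof (le_INR 2000 n Hn) as L; rewrite INR_IZR_INZ in L; exact L).
  assert (H2 : 0 < / (INR n + 2)) by (apply Rinv_0_lt_compat; lra).
  assert (Ht0 : 0 < t) by lra.
  (* The threshold 2000 enters here: [2000 * 0.0288 ^ 2 > 1.65]. *)
  assert (Ht : 0 < t <= 288 / 10000).
  { split; [lra|]. apply Rsqr_incr_0_var; [|lra]. unfold Rsqr.
    assert (2000 * t ^ 2 <= INR n * t ^ 2) by (apply Rmult_le_compat_r; [apply pow2_ge_0|lra]). lra. }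
  assert (Htail : exp (- (INR N * t)) / t <= / 2000).
  { assert (EN : INR N = (INR n + 2) ^ 3).
    { unfold N. rewrite pow_INR, plus_INR. simpl (INR 2). f_equal. }
    assert (Hm1 : 1 <= (INR n + 2) * t).
    { apply Rle_trans with ((INR n + 2) * / (INR n + 2)); [right; field; lra|].
      apply Rmult_le_compat_l; lra. }
    assert (HNt : (INR n + 2) <= INR N * t * t).
    { rewrite EN. replace ((INR n + 2) ^ 3 * t * t)
        with ((INR n + 2) * (((INR n + 2) * t) * ((INR n + 2) * t))) by ring.
      rewrite <- (Rmult_1_r (INR n + 2)) at 1. apply Rmult_le_compat_l; [lra|].
      rewrite <- (Rmult_1_r 1) at 1. apply Rmult_le_compat; lra. }
    assert (HNt' : 0 < INR N * t).
    { rewrite EN. apply Rmult_lt_0_compat; [apply pow_lt|]; lra. }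
    assert (He : exp (- (INR N * t)) <= / (INR N * t)).
    { rewrite exp_Ropp. apply Rinv_le_contravar; [exact HNt'|].
      pose proof (exp_ineq1_le (INR N * t)). lra. }
    apply Rle_trans with (/ (INR N * t) / t).
    - apply Rmult_le_compat_r; [left; apply Rinv_0_lt_compat; lra|exact He].
    - replace (/ (INR N * t) / t) with (/ (INR N * t * t)) by (field; split; nra).
      apply Rinv_le_contravar; lra. }
  destruct (fourier_log_concavity_gap t N n Ht Htail Hm) as [Hu Hgap].
  pose proof (euler_product_pos t N Ht0) as HP.
  assert (HF : forall j, (j <= N)%nat ->
    fourier t N (Z.of_nat j) = 2 * PI / euler_product t N * (INR (partition_number j) * exp (- (t * INR j)))).
  { intros j Hj. pose proof (coefficient_parts_le t N j Ht0) as H.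
    rewrite parts_le_partition_number in H by exact Hj.
    unfold coefficient in H. rewrite <- INR_IZR_INZ in H.
    assert (E : exp (t * INR j) * exp (- (t * INR j)) = 1)
      by (rewrite <- exp_plus, <- exp_0; f_equal; ring).
    apply (Rmult_eq_reg_l (euler_product t N)); [|lra].
    replace (euler_product t N * (2 * PI / euler_product t N * (INR (partition_number j) * exp (- (t * INR j)))))
      with (2 * PI * INR (partition_number j) * exp (- (t * INR j))) by (field; lra).
    rewrite <- H.
    transitivity (euler_product t N * fourier t N (Z.of_nat j) * (exp (t * INR j) * exp (- (t * INR j)))).
    - rewrite E. ring.
    - ring. }
  replace (Z.of_nat n - 1)%Z with (Z.of_nat (n - 1)) in Hgap by lia.
  replace (Z.of_nat n + 1)%Z with (Z.of_nat (n + 1)) in Hgap by lia.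
  rewrite !HF in Hgap by lia. rewrite HF in Hu by lia.
  set (K := 2 * PI / euler_product t N) in *.
  assert (HK : 0 < K) by (apply Rdiv_lt_0_compat; [pose proof PI_RGT_0; lra|exact HP]).
  pose proof (exp_pos (- (t * INR n))) as He.
  (* The radius cancels from the inequality because [n - 1] and [n + 1] average to [n]. *)
  assert (Ee : exp (- (t * INR (n - 1))) * exp (- (t * INR (n + 1))) = exp (- (t * INR n)) ^ 2).
  { rewrite exp_pow, <- exp_plus. f_equal. rewrite minus_INR, plus_INR by lia. simpl. ring. }
  set (e := exp (- (t * INR n))) in *.
  set (p := INR (partition_number n)) in *.
  set (pm := INR (partition_number (n - 1))) in *.
  set (pp := INR (partition_number (n + 1))) in *.
  assert (Hp : 0 <= p) by apply pos_INR. assert (Hpm : 0 <= pm) by apply pos_INR.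
  assert (Hpp : 0 <= pp) by apply pos_INR.
  split.
  - destruct Hp as [Hp|Hp]; [exact Hp|]. rewrite <- Hp, Rmult_0_l, Rmult_0_r in Hu. lra.
  - assert (Hg : p ^ 2 < (1 + 963 / 1000 * t ^ 3) * (pm * pp)).
    { apply (Rmult_lt_reg_l (K ^ 2 * e ^ 2)); [apply Rmult_lt_0_compat; apply pow_lt; assumption|].
      replace (K ^ 2 * e ^ 2 * p ^ 2) with ((K * (p * e)) ^ 2) by ring.
      eapply Rlt_le_trans; [exact Hgap|]. right. rewrite <- Ee. ring. }
    eapply Rlt_le_trans; [exact Hg|].
    apply Rmult_le_compat_r; [apply Rmult_le_pos; assumption|].
    pose proof (gap_constant_ge (INR n) t ltac:(lra) Ht0 Htb). lra.
Qed.

(** * Computation for small arguments *)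

Import ListNotations.

(** The list holds [p(j-1), ..., p(0)]: its head is [partition_pred j], lowering the index is
    [skipn], and an exhausted list stands for zeros. *)
Fixpoint pent_sums_list (f k : nat) (l : list N) : N * N :=
  match f, l with
  | S f', x :: _ =>
      let l' := skipn k l in
      let s := pent_sums_list f' (S k) (skipn (2 * k + 1) l') in
      (N.add (N.add x (hd 0%N l')) (snd s), fst s)
  | _, _ => (0%N, 0%N)
  end.

(* The test [N.eqb y y] forces the evaluation of [y] under lazy reduction. *)
Fixpoint partition_table (f k : nat) (l : list N) : list N :=
  match k with
  | O => l
  | S k' =>
      let s := pent_sums_list f 1 l in
      let y := N.sub (fst s) (snd s) in
      if N.eqb y y then partition_table f k' (y :: l) else []
  end.

Definition pN (j : nat) : N := N.of_nat (partition_number j).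
Definition rev_table (j : nat) : list N := rev (map pN (seq 0 j)).

Lemma rev_tableS j : rev_table (S j) = pN j :: rev_table j.
Proof. unfold rev_table. rewrite seq_S, map_app, rev_app_distr. reflexivity. Qed.

Lemma skipn_rev_table d : forall j, skipn d (rev_table j) = rev_table (j - d).
Proof.
  induction d as [|d IH]; intros j; [rewrite Nat.sub_0_r; reflexivity|].
  destruct j as [|j]; [reflexivity|]. rewrite rev_tableS. apply IH.
Qed.

Lemma hd_rev_table j : hd 0%N (rev_table j) = N.of_nat (partition_pred j).
Proof. destruct j as [|j]; [reflexivity|]. rewrite rev_tableS. reflexivity. Qed.

Lemma pent_sums_0 f : forall k, pent_sums f k 0 = (0%nat, 0%nat).
Proof.
  induction f as [|f IH]; intros k; [reflexivity|].
  rewrite pent_sumsS. simpl Nat.sub. rewrite IH. reflexivity.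
Qed.

Lemma pent_sums_list_correct f : forall k j,
  pent_sums_list f k (rev_table j)
  = (N.of_nat (fst (pent_sums f k j)), N.of_nat (snd (pent_sums f k j))).
Proof.
  induction f as [|f IH]; intros k j; [reflexivity|].
  destruct j as [|j]; [rewrite pent_sums_0; reflexivity|].
  rewrite pent_sumsS. rewrite rev_tableS. cbn [pent_sums_list]. rewrite <- rev_tableS.
  rewrite !skipn_rev_table, IH, hd_rev_table. cbn [fst snd].
  rewrite !Nnat.Nat2N.inj_add. reflexivity.
Qed.

Lemma partition_table_correct f k : forall j, (1 <= j)%nat -> (j + k <= S f)%nat ->
  partition_table f k (rev_table j) = rev_table (j + k).
Proof.
  induction k as [|k IH]; intros j Hj Hk; [rewrite Nat.add_0_r; reflexivity|].
  cbn [partition_table]. rewrite pent_sums_list_correct, N.eqb_refl. cbn [fst snd].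
  rewrite <- Nnat.Nat2N.inj_sub, <- partition_number_pent_sums by lia.
  change (N.of_nat (partition_number j)) with (pN j).
  rewrite <- rev_tableS, IH by lia. f_equal. lia.
Qed.

(* Rounding [a] and [c] down and [b] up to 20 leading bits only strengthens the test. *)
Definition gap_check (i a b c : N) : bool :=
  let s := (N.size b - 20)%N in
  let a' := N.shiftr a s in
  let b' := if N.eqb s 0 then b else N.succ (N.shiftr b s) in
  let c' := N.shiftr c s in
  let ac := (a' * c')%N in
  let d := (b' * b' - ac)%N in
  (N.ltb 0 b && N.ltb (d * d * (24 * i * (24 * i) * (24 * i))) (57600 * (ac * ac)))%bool.

(** The list starts at [p(i+1)], so [c], [b], [a] are [p(i+1)], [p(i)], [p(i-1)]. *)
Fixpoint gap_check_list (i : N) (l : list N) : bool :=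
  match l with
  | c :: ((b :: a :: _) as l') =>
    (N.ltb i 7 || (gap_check i a b c && gap_check_list (N.pred i) l'))%bool
  | _ => false
  end.

Definition RN (x : N) : R := IZR (Z.of_N x).

Lemma RN_of_nat k : RN (N.of_nat k) = INR k.
Proof. unfold RN. rewrite Znat.nat_N_Z, INR_IZR_INZ. reflexivity. Qed.

Lemma RN_le x y : (x <= y)%N -> RN x <= RN y.
Proof. intros H. apply IZR_le. lia. Qed.

Lemma RN_lt x y : (x < y)%N -> RN x < RN y.
Proof. intros H. apply IZR_lt. lia. Qed.

Lemma RN_mul x y : RN (x * y) = RN x * RN y.
Proof. unfold RN. rewrite Znat.N2Z.inj_mul, mult_IZR. reflexivity. Qed.

Lemma RN_add x y : RN (x + y) = RN x + RN y.
Proof. unfold RN. rewrite Znat.N2Z.inj_add, plus_IZR. reflexivity. Qed.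

Lemma RN_nonneg x : 0 <= RN x.
Proof. apply IZR_le. lia. Qed.

Lemma gap_check_correct i a b c : (0 < i)%N -> gap_check i a b c = true ->
  0 < RN b /\ RN b ^ 2 < (1 + 240 / Rpower (24 * RN i) (3 / 2)) * (RN a * RN c).
Proof.
  intros Hi H. unfold gap_check in H. apply Bool.andb_true_iff in H. destruct H as [Hb H].
  apply N.ltb_lt in Hb, H. split; [apply (RN_lt 0 b Hb)|].
  set (s := (N.size b - 20)%N) in *.
  set (a' := N.shiftr a s) in *. set (c' := N.shiftr c s) in *.
  set (b' := if N.eqb s 0 then b else N.succ (N.shiftr b s)) in *.
  set (d := (b' * b' - a' * c')%N) in *.
  assert (P : (0 < 2 ^ s)%N) by (apply N.neq_0_lt_0, N.pow_nonzero; lia).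
  assert (Ha : (a' * 2 ^ s <= a)%N).
  { unfold a'. rewrite N.shiftr_div_pow2, N.mul_comm. apply N.Div0.mul_div_le. }
  assert (Hc : (c' * 2 ^ s <= c)%N).
  { unfold c'. rewrite N.shiftr_div_pow2, N.mul_comm. apply N.Div0.mul_div_le. }
  assert (Hb' : (b <= b' * 2 ^ s)%N).
  { unfold b'. destruct (N.eqb_spec s 0) as [->|_]; [simpl; lia|].
    rewrite N.shiftr_div_pow2, N.mul_comm. apply N.lt_le_incl, N.mul_succ_div_gt. lia. }
  (* Holds also when the subtraction in [d] truncates to zero. *)
  assert (Hd : (b' * b' <= a' * c' + d)%N) by (unfold d; lia).
  apply RN_le in Ha, Hc, Hb', Hd. apply RN_lt in H, P.
  change (RN 0) with 0 in P.
  rewrite !RN_mul in *. rewrite RN_add, RN_mul in Hd.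
  change (RN 24) with 24 in H.
  change (RN 57600) with 57600 in H.
  pose proof (RN_nonneg a'). pose proof (RN_nonneg c'). pose proof (RN_nonneg d).
  pose proof (RN_nonneg b'). pose proof (RN_nonneg b). apply RN_lt in Hi. change (RN 0) with 0 in Hi.
  set (A := RN a') in *. set (C := RN c') in *. set (D := RN d) in *. set (B := RN b') in *.
  set (e := RN (2 ^ s)) in *.
  set (y := 24 * RN i) in *. assert (Hy : 0 < y) by (unfold y; lra).
  rewrite Rpower_three_halves by exact Hy.
  pose proof (sqrt_lt_R0 y Hy) as Hs. pose proof (sqrt_sqrt y ltac:(lra)) as Hss.
  set (w := y * sqrt y). assert (Hw : 0 < w) by (apply Rmult_lt_0_compat; lra).
  assert (Hw2 : y ^ 3 = w * w).
  { unfold w. replace (y * sqrt y * (y * sqrt y)) with (y * y * (sqrt y * sqrt y)) by ring.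
    rewrite Hss. ring. }
  replace (y * y * y) with (w * w) in H by (rewrite <- Hw2; ring).
  assert (HAC : 0 <= A * C) by (apply Rmult_le_pos; assumption).
  (* The integer test is the square of this inequality: [57600 = 240 ^ 2] and [w ^ 2 = y ^ 3], which
     removes the half-integral power. *)
  assert (HD : D * w < 240 * (A * C)).
  { apply Rsqr_incrst_0; [unfold Rsqr; lra|apply Rmult_le_pos; lra|lra]. }
  assert (HD' : D < 240 / w * (A * C)).
  { apply (Rmult_lt_reg_r w); [exact Hw|].
    replace (240 / w * (A * C) * w) with (240 * (A * C)) by (field; lra). exact HD. }
  apply Rle_lt_trans with ((B * e) ^ 2); [apply pow_incr; lra|].
  apply Rlt_le_trans with ((1 + 240 / w) * (A * e * (C * e))).
  - replace ((B * e) ^ 2) with (B * B * e ^ 2) by ring.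
    replace ((1 + 240 / w) * (A * e * (C * e))) with ((A * C + 240 / w * (A * C)) * e ^ 2) by ring.
    apply Rmult_lt_compat_r; [apply pow_lt, P|]. lra.
  - apply Rmult_le_compat_l.
    + assert (0 < 240 / w) by (apply Rdiv_lt_0_compat; lra). lra.
    + apply Rmult_le_compat; try lra; apply Rmult_le_pos; lra.
Qed.

Lemma gap_check_list_correct i :
  gap_check_list (N.of_nat i) (rev_table (S (S i))) = true ->
  forall n, (7 <= n <= i)%nat ->
  0 < INR (partition_number n) /\
  INR (partition_number n) ^ 2 < (1 + 240 / Rpower (24 * INR n) (3 / 2)) *
    (INR (partition_number (n - 1)) * INR (partition_number (n + 1))).
Proof.
  induction i as [|i IH]; intros H n Hn; [lia|].
  rewrite !rev_tableS in H.
  cbn [gap_check_list] in H.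
  apply Bool.orb_prop in H. destruct H as [H|H].
  - apply N.ltb_lt in H. lia.
  - apply Bool.andb_true_iff in H. destruct H as [H1 H2].
    destruct (Nat.eq_dec n (S i)) as [->|Hne].
    + apply gap_check_correct in H1; [|lia].
      unfold pN in H1. rewrite !RN_of_nat in H1.
      replace (S i - 1)%nat with i by lia. replace (S i + 1)%nat with (S (S i)) by lia. exact H1.
    + apply IH; [|lia]. rewrite !rev_tableS.
      replace (N.of_nat i) with (N.pred (N.of_nat (S i))) by lia. exact H2.
Qed.

Definition table_bound := N.to_nat 1999.

(** Two thousand steps from [p(0)] reach [p(2000)], which the test at [n = 1999] requires. *)
Lemma partition_table_check :
  gap_check_list (N.of_nat table_bound) (partition_table (S table_bound) (S table_bound) [1%N]) = true.
Proof. vm_cast_no_check (eq_refl true). Qed.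

Lemma partition_gap_small n : (7 <= n < 2000)%nat ->
  0 < INR (partition_number n) /\
  INR (partition_number n) ^ 2 < (1 + 240 / Rpower (24 * INR n) (3 / 2)) *
    (INR (partition_number (n - 1)) * INR (partition_number (n + 1))).
Proof.
  intros Hn.
  assert (Eb : Z.of_nat table_bound = 1999%Z) by (unfold table_bound; rewrite Znat.N_nat_Z; reflexivity).
  apply (gap_check_list_correct table_bound); [|lia].
  rewrite <- partition_table_check. apply (f_equal (gap_check_list (N.of_nat table_bound))).
  (* The table identity holds for every length; abstracting it keeps the concrete table from being
     unfolded. *)
  generalize (S table_bound). intros k.
  assert (E1 : rev_table 1 = [1%N]).
  { unfold rev_table, pN. simpl. rewrite <- (@parts_le_partition_number 0 0) by lia. reflexivity. }
  rewrite <- E1. symmetry. apply partition_table_correct; lia.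
Qed.

Theorem theorem4p2 (n : nat) (hn : (6 < n)%nat) :
  INR (partition_number (n - 1)) / INR (partition_number n)
    * (1 + 240 / Rpower (24 * INR n) (3 / 2))
  > INR (partition_number n) / INR (partition_number (n + 1)).
Proof.
  assert (H : 0 < INR (partition_number n) /\
    INR (partition_number n) ^ 2 < (1 + 240 / Rpower (24 * INR n) (3 / 2)) *
      (INR (partition_number (n - 1)) * INR (partition_number (n + 1)))).
  { destruct (Nat.lt_ge_cases n 2000) as [Hn|Hn];
      [apply partition_gap_small; lia|apply partition_gap_large, Hn]. }
  destruct H as [Hp H].
  set (p := INR (partition_number n)) in *.
  set (pm := INR (partition_number (n - 1))) in *.
  set (pp := INR (partition_number (n + 1))) in *.
  set (c := 1 + 240 / Rpower (24 * INR n) (3 / 2)) in *.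
  assert (Hpp : 0 < pp).
  { destruct (pos_INR (partition_number (n + 1))) as [H0|H0]; [exact H0|].
    fold pp in H0. rewrite <- H0, !Rmult_0_r in H. pose proof (pow2_ge_0 p). lra. }
  apply Rlt_gt, (Rmult_lt_reg_r (p * pp)); [apply Rmult_lt_0_compat; assumption|].
  replace (p / pp * (p * pp)) with (p ^ 2) by (field; lra).
  replace (pm / p * c * (p * pp)) with (c * (pm * pp)) by (field; lra).
  exact H.
Qed.
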